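(* Let $(M,J,g)$ be a metallic Riemannian manifold with $J^2=pJ+qI$, $p,q\in\mathbb R$, and let $\nabla$ be a linear connection on $M$. Define on the manifold $TM$ the $(1,1)$-tensor field $\bar J_m:=\Psi^\nabla\circ\hat J_m\circ(\Psi^\nabla)^{-1}$ and the Riemannian metric $\bar g:=((\Psi^\nabla)^{-1})^*(\hat g)$. Then $(TM,\bar J_m,\bar g)$ is a metallic Riemannian manifold (with the same $p,q$).
   Context: A metallic Riemannian manifold $(M,J,g)$ is a smooth manifold with a $(1,1)$-tensor field $J$ satisfying $J^2=pJ+qI$ for some real $p,q$ and a Riemannian metric $g$ with $g(JX,Y)=g(X,JY)$ for all vector fields $X,Y$. $\flat_g(X):=i_Xg$, $\sharp_g:=\flat_g^{-1}$, $(J^*\alpha)(X):=\alpha(JX)$. On $TM\oplus T^*M$: $\hat J_m(X+\alpha):=JX+J^*\alpha$ and $\hat g(X+\alpha,Y+\beta):=g(X,Y)+g(\sharp_g\alpha,\sharp_g\beta)$. Let $\pi:TM\to M$ be the projection. The connection $\nabla$ gives the splitting $T(TM)=T^H(TM)\oplus T^V(TM)$ into horizontal and vertical subbundles. For $a\in TM$, $X\in T_{\pi(a)}M$ and $\alpha\in T^*_{\pi(a)}M$, set $\Psi^\nabla(X+\alpha):=X^H_a+\chi_a(\sharp_g\alpha)\in T_a(TM)$, where $X^H_a$ is the horizontal lift of $X$ to $a$ and $\chi_a:T_{\pi(a)}M\to T_a(T_{\pi(a)}M)\subset T_a(TM)$ is the standard identification; for each $a$ this is a linear isomorphism $T_{\pi(a)}M\oplus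 T^*_{\pi(a)}M\to T_a(TM)$, and $\bar J_m,\bar g$ are defined by transporting $\hat J_m,\hat g$ at $\pi(a)$ to $T_a(TM)$ through it. *)

(* Defs.v *)
From mathcomp Require Import all_boot all_order all_algebra.
From mathcomp Require Import all_classical all_reals all_analysis.
Set Implicit Arguments.
Unset Strict Implicit.
Unset Printing Implicit Defensive.
Import Order.TTheory GRing.Theory Num.Theory.
Import numFieldNormedType.Exports.
Local Open Scope classical_set_scope.
Local Open Scope ring_scope.

(* C^k by iterated directional derivatives.  It is only used for open U, where
   the values of f outside U are irrelevant. *)
Fixpoint Ck_on (R : realType) (V W : normedModType R) (k : nat) (U : set V)
    (f : V -> W) : Prop :=
  if k is k'.+1 then
    (forall x, U x -> differentiable f x) /\
    (forall v : V, Ck_on k' U (fun x => 'd f x v))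
  else forall x, U x -> {for x, continuous f}.

Definition smooth_on (R : realType) (V W : normedModType R) (U : set V)
    (f : V -> W) : Prop := forall k, Ck_on k U f.

(* A set with charts onto subsets of R^n.  [cochart i] inverts [chart i] and is
   meaningful only on the image of [dom i].  [pref] picks one chart around each
   point: every tangent space T_xM is represented by 'rV[R]_n, a vector being
   identified with its coordinates in the chart [pref x].  No topology is
   carried: it is the one induced by the charts, see [mfd_open]. *)
Record atlas (R : realType) (n : nat) := Atlas {
  carrier :> Type;
  chart_index : Type;
  dom : chart_index -> set carrier;
  chart : chart_index -> carrier -> 'rV[R]_n;
  cochart : chart_index -> 'rV[R]_n -> carrier;
  pref : carrier -> chart_index }.

Arguments dom {R n} M : rename.
Arguments chart {R n} M : rename.
Arguments cochart {R n} M : rename.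
Arguments pref {R n} M : rename.

Definition mfd_open (R : realType) (n : nat) (M : atlas R n) (A : set M) :=
  forall i, open (chart M i @` (A `&` dom M i)).

(* Charts are homeomorphisms onto open subsets of R^n, so second countability
   amounts to the existence of a countable family of charts covering M. *)
Record is_manifold (R : realType) (n : nat) (M : atlas R n) : Prop := {
  mfd_pref : forall x : M, dom M (pref M x) x;
  mfd_chartK : forall i (x : M), dom M i x -> cochart M i (chart M i x) = x;
  mfd_overlap : forall i j, open (chart M i @` (dom M i `&` dom M j));
  mfd_transition : forall i j,
    smooth_on (chart M i @` (dom M i `&` dom M j)) (chart M j \o cochart M i);
  mfd_hausdorff : forall x y : M, x <> y -> exists A B : set M,
    [/\ mfd_open A, mfd_open B, A x, B y & A `&` B = set0];
  mfd_countable : exists2 I : set (chart_index M),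
    countable I & forall x : M, exists2 i, I i & dom M i x }.

Section Manifold.
Variables (R : realType) (n : nat) (M : atlas R n).

Definition chart_range (i : chart_index M) : set 'rV[R]_n :=
  chart M i @` dom M i.

(* Change of coordinates on T_xM between [pref x] and the chart [i]. *)
Definition to_coords (i : chart_index M) (x : M) (v : 'rV[R]_n) : 'rV[R]_n :=
  'd (chart M i \o cochart M (pref M x)) (chart M (pref M x) x) v.

Definition of_coords (i : chart_index M) (x : M) (w : 'rV[R]_n) : 'rV[R]_n :=
  'd (chart M (pref M x) \o cochart M i) (chart M i x) w.

Definition smooth_fun (f : M -> R) : Prop :=
  forall i, smooth_on (chart_range i) (f \o cochart M i : _ -> R^o).

Definition smooth_field (X : M -> 'rV[R]_n) : Prop :=
  forall i, smooth_on (chart_range i)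
    (fun y => let x := cochart M i y in to_coords i x (X x)).

Definition tensor11 (J : M -> 'rV[R]_n -> 'rV[R]_n) : Prop :=
  (forall x, linear (J x)) /\
  (forall i v, smooth_on (chart_range i)
    (fun y => let x := cochart M i y in to_coords i x (J x (of_coords i x v)))).

Record riemannian_metric (g : M -> 'rV[R]_n -> 'rV[R]_n -> R) : Prop := {
  riem_linear : forall x u, linear (g x u : 'rV[R]_n -> R^o);
  riem_sym : forall x u v, g x u v = g x v u;
  riem_pos : forall x (u : 'rV[R]_n), u != 0 -> 0 < g x u u;
  riem_smooth : forall i v w, smooth_on (chart_range i)
    (fun y => let x := cochart M i y in
       g x (of_coords i x v) (of_coords i x w) : R^o) }.

Record metallic_riemannian (p q : R) (J : M -> 'rV[R]_n -> 'rV[R]_n)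
    (g : M -> 'rV[R]_n -> 'rV[R]_n -> R) : Prop := {
  metallic_manifold : is_manifold M;
  metallic_tensor : tensor11 J;
  metallic_metric : riemannian_metric g;
  metallic_eq : forall x u, J x (J x u) = p *: J x u + q *: u;
  metallic_compat : forall x u v, g x (J x u) v = g x u (J x v) }.

Definition dfun (f : M -> R) (x : M) (v : 'rV[R]_n) : R :=
  'd (f \o cochart M (pref M x) : _ -> R^o) (chart M (pref M x) x) v.

(* [D X Y] is nabla_X Y; nothing is required of D on non-smooth arguments. *)
Record linear_connection
    (D : (M -> 'rV[R]_n) -> (M -> 'rV[R]_n) -> M -> 'rV[R]_n) : Prop := {
  conn_smooth : forall X Y, smooth_field X -> smooth_field Y ->
    smooth_field (D X Y);
  conn_addl : forall X X' Y,
    smooth_field X -> smooth_field X' -> smooth_field Y ->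
    forall x, D (fun z => X z + X' z) Y x = D X Y x + D X' Y x;
  conn_scalel : forall f X Y,
    smooth_fun f -> smooth_field X -> smooth_field Y ->
    forall x, D (fun z => f z *: X z) Y x = f x *: D X Y x;
  conn_addr : forall X Y Y',
    smooth_field X -> smooth_field Y -> smooth_field Y' ->
    forall x, D X (fun z => Y z + Y' z) x = D X Y x + D X Y' x;
  conn_leibniz : forall f X Y,
    smooth_fun f -> smooth_field X -> smooth_field Y ->
    forall x, D X (fun z => f z *: Y z) x =
              dfun f x (X x) *: Y x + f x *: D X Y x }.

(* The point (x, v) of TM is the vector of T_xM with [pref x]-coordinates v.
   The chart of TM induced by [i] is (x, v) |-> (coordinates of x, of v). *)
Definition tangent_bundle : atlas R (n + n) := {|
  carrier := (M * 'rV[R]_n)%type;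
  chart_index := chart_index M;
  dom := fun i => [set a | dom M i a.1];
  chart := fun i a => row_mx (chart M i a.1) (to_coords i a.1 a.2);
  cochart := fun i y => let x := cochart M i (lsubmx y) in
                        (x, of_coords i x (rsubmx y));
  pref := fun a => pref M a.1 |}.

End Manifold.

Definition tangent_map (R : realType) (m n : nat) (M : atlas R m)
    (N : atlas R n) (F : M -> N) (x : M) (v : 'rV[R]_m) : 'rV[R]_n :=
  'd (chart N (pref N (F x)) \o F \o cochart M (pref M x))
     (chart M (pref M x) x) v.

Definition velocity (R : realType) (n : nat) (M : atlas R n) (c : R -> M)
  : 'rV[R]_n := derive1 (chart M (pref M (c 0)) \o c) 0.

Section Lift.
Variables (R : realType) (n : nat) (M : atlas R n).
Variables (J : M -> 'rV[R]_n -> 'rV[R]_n).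
Variables (g : M -> 'rV[R]_n -> 'rV[R]_n -> R).
Variables (D : (M -> 'rV[R]_n) -> (M -> 'rV[R]_n) -> M -> 'rV[R]_n).

Notation cotangent := 'Hom('rV[R]_n, R^o).
Notation TM := (tangent_bundle M).

Definition flat (x : M) (u : 'rV[R]_n) : cotangent :=
  linfun (g x u : 'rV[R]_n -> R^o).

Definition sharp (x : M) (alpha : cotangent) : 'rV[R]_n :=
  xget 0 [set u | flat x u = alpha].

Definition dualJ (x : M) (alpha : cotangent) : cotangent :=
  linfun (fun u => alpha (J x u)).

Definition hatJ (x : M) (z : 'rV[R]_n * cotangent) : 'rV[R]_n * cotangent :=
  (J x z.1, dualJ x z.2).

Definition hatg (x : M) (z z' : 'rV[R]_n * cotangent) : R :=
  g x z.1 z'.1 + g x (sharp x z.2) (sharp x z'.2).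

Definition chi (a : TM) (u : 'rV[R]_n) : 'rV[R]_(n + n) :=
  @velocity R (n + n) TM (fun t => (a.1, a.2 + t *: u)).

(* The horizontal lift at a of v in T_{pi(a)}M is dY(v) - chi_a(nabla_X Y) for
   any vector fields X, Y taking the values v and a at pi(a). *)
Definition hlift (a : TM) (v : 'rV[R]_n) : 'rV[R]_(n + n) :=
  xget 0 [set w | exists X Y : M -> 'rV[R]_n,
    [/\ smooth_field X, smooth_field Y, X a.1 = v, Y a.1 = a.2 &
        w = @tangent_map R n (n + n) M TM (fun x => (x, Y x)) a.1 v
            - chi a (D X Y a.1)]].

Definition Psi (a : TM) (z : 'rV[R]_n * cotangent) : 'rV[R]_(n + n) :=
  hlift a z.1 + chi a (sharp a.1 z.2).

Definition Psi_inv (a : TM) (w : 'rV[R]_(n + n)) : 'rV[R]_n * cotangent :=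
  xget 0 [set z | Psi a z = w].

Definition barJ (a : TM) (w : 'rV[R]_(n + n)) : 'rV[R]_(n + n) :=
  Psi a (hatJ a.1 (Psi_inv a w)).

Definition barg (a : TM) (w w' : 'rV[R]_(n + n)) : R :=
  hatg a.1 (Psi_inv a w) (Psi_inv a w').

End Lift.

(* Main.v *)
Require Import Defs.
From HB Require Import structures.
From mathcomp Require Import all_boot all_order all_algebra.
From mathcomp Require Import ring lra.
From mathcomp Require Import all_classical all_reals all_analysis.
Set Implicit Arguments.
Unset Strict Implicit.
Unset Printing Implicit Defensive.
Import Order.TTheory GRing.Theory Num.Theory.
Import numFieldNormedType.Exports.
Local Open Scope classical_set_scope.
Local Open Scope ring_scope.

(** Fix a point a = (x, u) of TM. The map that sends (X, alpha) to the horizontal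
lift of X plus the vertical lift of sharp alpha is a linear isomorphism
from T_xM + T*_xM to T_a(TM). Since J is self-adjoint for g, the transpose of J
corresponds to J under sharp. Hence, once covectors are identified with
vectors, the transported structure is J on each of the two summands and the
transported metric is the orthogonal sum of two copies of g
([barJ_hvlift], [barg_hvlift]). The metallic equation, the symmetry and positivity
of the metric and the compatibility are then inherited summand by summand.

The rest is smoothness. In the chart of TM induced by a chart of M, the
horizontal lift at a vector of components u of the vector of components v is
(v, - Gamma(u, v)), where Gamma is the bilinear map of the Christoffel symbols
([hlift_chart]), and vertical lifts have components (0, w). So the isomorphism is
in coordinates a shear with an explicit smooth inverse, and the chart expressions
of the transported tensors are polynomial in those of J, g and in the Christoffel
symbols, hence smooth ([barJ_smooth], [barg_smooth]).

The definition of the horizontal lift quantifies over global vector fields and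
the connection is only an operator on global fields. Everything therefore rests
on [local_frame]: multiplying by bump functions ([bump_exists]) and extending by
zero, which is smooth because compact sets are closed in a Hausdorff manifold
([smooth_on_patch]), one gets global fields that restrict to the coordinate frame
near a given point. They show that prescribed values at a point are attained by
global fields, that the lift does not depend on the fields used to define it, and
that the Christoffel symbols are smooth.

Finally TM is a manifold ([tangent_bundle_manifold]) because its transition maps
are the tangent maps of those of M. *)

(** * Calculus of maps of class C^k *)

Section Germ.
Variables (R : realType) (V W : normedModType R).
Implicit Types (f g : V -> W) (U : set V) (x v : V).

(** The expansion with remainder o(h) that characterizes the differential only sees
the germ, and it determines the differential uniquely. *)
Lemma near_eq_is_diff f g df x :
  (\near x, f x = g x) -> is_diff x f df -> is_diff x g df.
Proof.
move=> fg [fx dfE].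
have e : g \o shift x = cst (g x) + 'd f x +o_ 0 id.
  apply/eqaddoP => eps e0.
  have /diff_locally /eqaddoP /(_ eps e0) h := fx.
  have gx : f x = g x by apply: nbhs_singleton fg.
  have fgt : \forall t \near (0 : V), f (shift x t) = g (shift x t).
    have : (shift x y) @[y --> (0:V)] --> x.
      rewrite -[X in _ --> X]add0r; apply: cvgD; first exact: cvg_id.
      exact: cvg_cst.
    by move=> /(_ _ fg).
  near=> t.
  have -> : (g \o shift x - (cst (g x) + 'd f x)) t
          = (f \o shift x - (cst (f x) + 'd f x)) t.
    by rewrite !fctE /= gx; congr (_ - _); apply/esym; near: t.
  by near: t.
have c : continuous ('d f x) by apply: diff_continuous.
have dg : 'd g x = 'd f x :> (V -> W) by apply: diff_unique.
split; last by rewrite dg.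
by apply/diff_locallyP; rewrite dg.
Unshelve. all: by end_near. Qed.

Lemma open_near U f g x : open U -> U x -> {in U, f =1 g} ->
  \near x, f x = g x.
Proof.
move=> oU Ux fg; apply: filterS (open_nbhs_nbhs (conj oU Ux)) => y Uy.
by apply: fg; rewrite inE.
Qed.

Lemma eq_on_is_diff U f g df x : open U -> U x -> {in U, f =1 g} ->
  is_diff x f df -> is_diff x g df.
Proof. by move=> oU Ux fg; apply: near_eq_is_diff; apply: (open_near oU). Qed.

Lemma eq_on_diff U f g x : open U -> U x -> {in U, f =1 g} ->
  differentiable f x -> 'd g x = 'd f x :> (V -> W).
Proof.
move=> oU Ux fg df.
exact: (diff_val (is_diff_def := eq_on_is_diff oU Ux fg (differentiableP df))).
Qed.

Lemma eq_on_differentiable U f g x : open U -> U x -> {in U, f =1 g} ->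
  differentiable f x -> differentiable g x.
Proof.
move=> oU Ux fg df.
exact: (ex_diff (is_diff_def := eq_on_is_diff oU Ux fg (differentiableP df))).
Qed.

Lemma Ck_on_eq k U f g : open U -> {in U, f =1 g} ->
  Ck_on k U f -> Ck_on k U g.
Proof.
move=> oU; elim: k f g => [|k IH] f g fg /= .
  move=> cf x Ux; have nfg := open_near oU Ux fg.
  have fx : f x = g x by apply: nbhs_singleton nfg.
  rewrite /prop_for /continuous_at -fx; apply: cvg_trans (cf x Ux).
  by apply: near_eq_cvg.
move=> [df cf]; split=> [x Ux|v].
  by apply: (eq_on_differentiable oU Ux fg); exact: df.
apply: IH (cf v) => x; rewrite inE => Ux.
by rewrite (eq_on_diff oU Ux fg (df x Ux)).
Qed.

Lemma Ck_on_sub k U U' f : U `<=` U' -> Ck_on k U' f -> Ck_on k U f.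
Proof.
move=> UU; elim: k f => [|k IH] f /=; first by move=> cf x /UU; apply: cf.
by move=> [df cf]; split=> [x /UU|v]; [exact: df | apply: IH].
Qed.

Lemma Ck_on_local k U f :
  (forall x, U x -> exists2 O : set V, O x & Ck_on k O f) -> Ck_on k U f.
Proof.
elim: k f => [|k IH] f h /=.
  by move=> x /h[Y Yx]; apply.
split=> [x /h[Y Yx [+ _]]|v]; first by apply.
by apply: IH => x /h[Y Yx [_ /(_ v) cf]]; exists Y.
Qed.

(** The way to raise the order of differentiability in all the inductions below:
exhibit an explicit differential, of class C^k in the point. *)
Lemma Ck_onS_is_diff k U f (df : V -> V -> W) : open U ->
  (forall x, U x -> is_diff x f (df x)) ->
  (forall v, Ck_on k U (df ^~ v)) -> Ck_on k.+1 U f.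
Proof.
move=> oU dfP cdf; split=> [x /dfP[] // | v].
apply: Ck_on_eq (cdf v) => // x; rewrite inE => /dfP[_ ->].
by [].
Qed.

Lemma Ck_onW k U f : Ck_on k.+1 U f -> Ck_on k U f.
Proof.
elim: k f => [|k IH] f /= [df cf].
  by move=> x Ux; apply: differentiable_continuous; exact: df.
by split=> // v; apply: IH.
Qed.

Lemma Ck_cst k U (a : W) : open U -> Ck_on k U (fun _ => a).
Proof.
move=> oU; elim: k a => [|k IH] a.
  by move=> x _; apply: cst_continuous.
by apply: (Ck_onS_is_diff (df := fun _ _ => 0)) => // x _; apply: is_diff_cst.
Qed.

Lemma CkD k U f g : open U -> Ck_on k U f -> Ck_on k U g ->
  Ck_on k U (fun x => f x + g x).
Proof.
move=> oU; elim: k f g => [|k IH] f g.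
  by move=> cf cg x Ux; apply: continuousD; [exact: cf|exact: cg].
move=> [df cf] [dg cg].
apply: (Ck_onS_is_diff (df := fun x v => 'd f x v + 'd g x v)) => // [x Ux|v].
  by apply: is_diffD; apply: differentiableP; [exact: df|exact: dg].
exact: IH (cf v) (cg v).
Qed.

Lemma Ck_sum k U n (f : 'I_n -> V -> W) : open U ->
  (forall i, Ck_on k U (f i)) -> Ck_on k U (fun x => \sum_i f i x).
Proof.
move=> oU; elim: n f => [|n IH] f cf.
  by apply: (Ck_on_eq (f := fun _ => 0)) => // [x _|]; [rewrite big_ord0|exact: Ck_cst].
apply: (Ck_on_eq (f := fun x => f ord0 x + \sum_i f (lift ord0 i) x)) => //.
  by move=> x _; rewrite big_ord_recl.
by apply: CkD => //; apply: IH.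
Qed.

End Germ.

Section Linear.
Variables (R : realType) (V W Z : normedModType R).

Lemma Ck_linear_comp k (U : set V) (f : V -> W) (L : {linear W -> Z}) :
  continuous L -> open U -> Ck_on k U f -> Ck_on k U (fun x => L (f x)).
Proof.
move=> cL oU; elim: k f => [|k IH] f.
  by move=> cf x Ux; apply: continuous_comp; [exact: cf|exact: cL].
move=> [df cf].
apply: (Ck_onS_is_diff (df := fun x v => L ('d f x v))) => // [x Ux|v].
  have := is_diff_comp (differentiableP (df x Ux))
    (differentiableP (linear_differentiable (f x) cL)).
  by rewrite (diff_lin _ cL).
exact: IH (cf v).
Qed.

Lemma Ck_linear k (U : set V) (L : {linear V -> W}) :
  continuous L -> open U -> Ck_on k U L.
Proof.
move=> cL oU; case: k => [|k]; first by move=> x _; exact: cL.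
apply: (Ck_onS_is_diff (df := fun x v => L v)) => // [x Ux|v].
  by split; [exact: linear_differentiable | exact: diff_lin].
exact: Ck_cst.
Qed.

End Linear.

Section Scale.
Variables (R : realType) (V W : normedModType R).

Lemma scale_is_bilinear :
  bilinear_for
    (GRing.Scale.Law.clone _ _ *:%R _) (GRing.Scale.Law.clone _ _ *:%R _)
    (@GRing.scale R W : R^o -> W -> W).
Proof.
split=> [u'|u] a x y /=.
- by rewrite scalerDl scalerA.
- by rewrite scalerDr !scalerA mulrC.
Qed.
HB.instance Definition _ := bilinear_isBilinear.Build R R^o W W _ _
  (@GRing.scale R W : R^o -> W -> W) scale_is_bilinear.

(** The product rule, as the differential of the bilinear map scaling. *)
Lemma is_diff_scale (f : V -> R^o) (g : V -> W) df dg x :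
  is_diff x f df -> is_diff x g dg ->
  is_diff x (fun z => f z *: g z) (fun v => f x *: dg v + df v *: g x).
Proof.
move=> fx gx; have fgx := is_diff_pair fx gx.
pose s := (@GRing.scale R W : R^o -> W -> W).
have c : continuous (fun p : R^o * W => s p.1 p.2) by apply: scale_continuous.
have h : is_diff (f x, g x) (fun q : R^o * W => s q.1 q.2)
    (fun q => f x *: q.2 + q.1 *: g x).
  by split; [exact: differentiable_bilin | exact: diff_bilin].
exact: is_diff_comp fgx h.
Qed.

Lemma CkZ k U (f : V -> R^o) (g : V -> W) : open U ->
  Ck_on k U f -> Ck_on k U g -> Ck_on k U (fun x => f x *: g x).
Proof.
move=> oU; elim: k f g => [|k IH] f g.
  by move=> cf cg x Ux; apply: continuousZ; [exact: cf|exact: cg].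
move=> cf' cg'; have [df cf] := cf'; have [dg cg] := cg'.
apply: (Ck_onS_is_diff (df := fun x v => f x *: 'd g x v + 'd f x v *: g x)) => //.
  move=> x Ux; apply: is_diff_scale; apply: differentiableP;
  [exact: df|exact: dg].
move=> v; apply: CkD => //.
  exact: IH (Ck_onW cf') (cg v).
exact: IH (cf v) (Ck_onW cg').
Qed.

End Scale.

Section Coordinates.
Variables (R : realType).

(** Finite dimension, in the form the chain rule needs: [Ck_on] differentiates in
one constant direction at a time, so the differential of a composite has to be
expanded on a fixed basis of the intermediate space. *)
Definition fin_coords (W : normedModType R) := exists m (e : 'I_m -> W)
  (c : 'I_m -> {linear W -> R^o}),
  (forall i, continuous (c i)) /\ forall w, w = \sum_i c i w *: e i.

Lemma fin_coords_scalar : fin_coords R^o.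
Proof.
exists 1%N, (fun _ => 1), (fun _ => idfun : {linear R^o -> R^o}).
split=> [i x|w]; first exact: cvg_id.
by rewrite big_ord1 /=; rewrite /GRing.scale /= mulr1.
Qed.

Definition rv_coord n (j : 'I_n) (v : 'rV[R]_n) : R^o := v ord0 j.

Lemma rv_coord_is_linear n j : linear (@rv_coord n j).
Proof. by move=> a u v; rewrite /rv_coord !mxE. Qed.
HB.instance Definition _ n j := GRing.isLinear.Build R 'rV[R]_n R^o _
  (@rv_coord n j) (@rv_coord_is_linear n j).

Lemma rv_coord_continuous n j : continuous (@rv_coord n j).
Proof. exact: coord_continuous. Qed.

Definition rv_basis n (j : 'I_n) : 'rV[R]_n := delta_mx 0 j.

Lemma rv_sum n (v : 'rV[R]_n) : v = \sum_j rv_coord j v *: rv_basis j.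
Proof. exact: row_sum_delta. Qed.

Lemma fin_coords_rV n : fin_coords 'rV[R]_n.
Proof.
exists n, (@rv_basis n), (fun j => @rv_coord n j); split.
  exact: rv_coord_continuous.
exact: rv_sum.
Qed.

Lemma linear_rv_sum n (W : lmodType R) (L : {linear 'rV[R]_n -> W}) v :
  L v = \sum_j rv_coord j v *: L (rv_basis j).
Proof.
by rewrite {1}[v]rv_sum linear_sum; apply: eq_bigr => j _; rewrite linearZ.
Qed.

Lemma linear_rV_continuous n (W : normedModType R) (L : {linear 'rV[R]_n -> W}) :
  continuous L.
Proof.
have -> : (L : 'rV[R]_n -> W) =
    fun v => \sum_j rv_coord j v *: L (rv_basis j).
  by apply/funext => v; exact: linear_rv_sum.
suff h : Ck_on 0 setT (fun v => \sum_j rv_coord j v *: L (rv_basis j)).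
  by move=> x; apply: h.
apply: Ck_sum openT _ => j; apply: CkZ openT _ _; last exact/Ck_cst/openT.
by apply: (Ck_linear 0 _ openT); exact: rv_coord_continuous.
Qed.

(** With [e] a basis of [W] and [c] its coordinates, the differential of the
composite in the direction [v] is
[\sum_i c i ('d f x v) *: 'd g (f x) (e i)], a combination of composites of
class C^k, to which the induction hypothesis applies for all [g] at once. *)
Lemma Ck_comp (V W Z : normedModType R) k (U : set V) (U' : set W)
    (f : V -> W) (g : W -> Z) : fin_coords W -> open U -> open U' ->
  (forall x, U x -> U' (f x)) -> Ck_on k U f -> Ck_on k U' g ->
  Ck_on k U (fun x => g (f x)).
Proof.
move=> [m [e [c [cc ec]]]] oU oU' UU'; elim: k f g UU' => [|k IH] f g UU'.
  move=> cf cg x Ux; apply: continuous_comp; first exact: cf.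
  by apply: cg; exact: UU'.
move=> cf' cg'; have [df cf] := cf'; have [dg cg] := cg'.
apply: (Ck_onS_is_diff (df := fun x v =>
  \sum_i (c i ('d f x v) : R^o) *: 'd g (f x) (e i))) => //.
  move=> x Ux; have := is_diff_comp (differentiableP (df x Ux))
    (differentiableP (dg _ (UU' x Ux))).
  congr is_diff_def; apply/funext => v /=.
  by rewrite {1}[ 'd f x v]ec linear_sum; apply: eq_bigr => i _; rewrite linearZ.
move=> v; apply: Ck_sum => // i; apply: CkZ => //.
  by apply: Ck_linear_comp => //; exact: cf.
exact: IH UU' (Ck_onW cf') (cg (e i)).
Qed.

Lemma CkV (V : normedModType R) k (U : set V) (f : V -> R^o) : open U ->
  (forall x, U x -> f x != 0) -> Ck_on k U f ->
  Ck_on k U (fun x => (f x)^-1 : R^o).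
Proof.
move=> oU f0; elim: k => [|k IH] cf'.
  by move=> x Ux; apply: continuousV; [exact: f0|exact: cf'].
have [df cf] := cf'; have cV := IH (Ck_onW cf').
apply: (Ck_onS_is_diff (df := fun x v =>
   ((-1 : R^o) *: ((f x)^-1 *: ((f x)^-1 *: 'd f x v))) : R^o)) => //.
  move=> x Ux; split; first by apply: differentiableV; [exact: df|exact: f0].
  rewrite diffV ?f0 //; last exact: df.
  apply/funext => v /=; rewrite scaleN1r scalerA scaleNr.
  by rewrite -invfM expr2.
move=> v; apply: CkZ => //; first exact: Ck_cst.
by do 2 (apply: CkZ => //); exact: cf.
Qed.

End Coordinates.

(** * Bump functions *)

Section FlatExp.
Variable R : realType.

(** The functions t^-m exp(-1/t) on the positive half-line, extended by zero. The
whole family is considered because it is stable under differentiation up to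
linear combinations, which makes smoothness an induction. *)
Definition flat_exp (m : nat) (t : R^o) : R^o :=
  if (0 : R) < t then (t^-1) ^+ m * expR (- t^-1) else 0.

Lemma flat_exp_le0 m (t : R) : t <= 0 -> flat_exp m t = 0.
Proof. by rewrite /flat_exp ltNge => ->. Qed.

Lemma flat_exp_gt0 m (t : R) : 0 < t -> (0 : R) < flat_exp m t.
Proof. by move=> t0; rewrite /flat_exp t0 mulr_gt0 ?expR_gt0 ?exprn_gt0 ?invr_gt0. Qed.

Lemma flat_exp_ge0 m (t : R) : (0 : R) <= flat_exp m t.
Proof.
by case: (leP t 0) => t0; [rewrite flat_exp_le0 | rewrite ltW ?flat_exp_gt0].
Qed.

Lemma flat_expM m (t : R) : flat_exp m t = flat_exp m.+1 t * t.
Proof.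
rewrite /flat_exp; case: ifPn => t0; last by rewrite mul0r.
by rewrite exprS mulrC; field; rewrite gt_eqF.
Qed.

(** All the functions of the family vanish at 0 at least linearly, because the
exponential of 1/t dominates every power of 1/t. *)
Lemma flat_exp_bound m (t : R) : flat_exp m t <= (m.+1)`!%:R * `|t|.
Proof.
case: (leP t 0) => t0; first by rewrite flat_exp_le0 // mulr_ge0.
rewrite /flat_exp t0 gtr0_norm // expRN.
have ti : 0 <= t^-1 by rewrite invr_ge0 ltW.
have h := expR_ge1Dxn m ti.
have {}h : t^-1 ^+ m.+1 / (m.+1)`!%:R <= expR t^-1.
  by apply: le_trans h; rewrite lerDr.
rewrite ler_pdivrMr ?expR_gt0 //.
have f0 : 0 < (m.+1)`!%:R :> R by rewrite ltr0n fact_gt0.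
apply: le_trans (ler_wpM2l _ h); last by rewrite mulr_ge0 ?ltW.
rewrite exprS; set E := t^-1 ^+ m; set F := _%:R in f0 *.
rewrite le_eqVlt; apply/orP; left; apply/eqP; field.
by rewrite !gt_eqF.
Qed.

Definition flat_exp' m (t : R) : R :=
  - m%:R * flat_exp m.+1 t + flat_exp m.+2 t.

(** Away from 0 this is a computation. At 0 the difference quotient of
[flat_exp m] is [flat_exp m.+1], which tends to 0 by [flat_exp_bound]. *)
Lemma is_diff_flat_exp m (t : R^o) :
  is_diff t (flat_exp m) (fun v : R^o => v * flat_exp' m t : R^o).
Proof.
suff h : is_derive (t : R) 1 (flat_exp m : R -> R) (flat_exp' m t).
  have [dt et] := h; split; first exact/derivable1_diffP.
  by rewrite deriv1E // derive1E et.
have [t0|t0|->] := ltgtP t 0.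
- have -> : flat_exp' m t = 0 by rewrite /flat_exp' !flat_exp_le0 ?ltW// mulr0 addr0.
  apply: (near_eq_is_derive (f := cst (0 : R) : R -> R)).
    near=> s; rewrite flat_exp_le0 // ltW //; near: s; exact: lt_nbhsl.
- have tn0 : t != 0 by rewrite gt_eqF.
  apply: (near_eq_is_derive
      (f := (fun s : R => s^-1) ^+ m * (expR \o (fun s : R => - s^-1)))).
    near=> s; rewrite /flat_exp ifT ?exprfctE //; near: s; exact: lt_nbhsr.
  have di : is_derive (t : R) 1 (fun s : R => s^-1) (- t ^- 2).
    split; first by apply: derivableV => //; exact: derivable_id.
    by rewrite deriveV // ?derive_id // /GRing.scale /= ?mulr1.
  have de : is_derive (t : R) 1 (expR \o (fun s : R => - s^-1))
      (expR (- t^-1) * t ^- 2).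
    have dn : derivable (fun s : R => - s^-1) t 1 by apply: derivableN; case: di.
    have dx : derivable expR (- t^-1) 1 by exact: derivable_expR.
    split; first by apply/derivable1_diffP/differentiable_comp;
      apply/derivable1_diffP.
    rewrite -derive1E derive1_comp // !derive1E.
    rewrite (@derive_val _ _ _ _ _ _ _ (is_derive_expR _)) deriveN; last by case: di.
    by case: di => _ ->; rewrite opprK.
  apply: (is_derive_eq (is_deriveM (is_deriveX m di) de)).
  rewrite /flat_exp' /flat_exp t0 /GRing.scale /= exprfctE -exprVn.
  move: (t^-1 : R) (expR _ : R) => u e.
  case: (m) => [|m'] /=; first by rewrite !mul0r !mulr0; ring.
  by rewrite !exprS; ring.
- have e0 : flat_exp' m 0 = 0 by rewrite /flat_exp' !flat_exp_le0 ?mulr0 ?addr0.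
  rewrite e0.
  have cv : (fun h : R => h^-1 *:
      ((flat_exp m \o shift 0) (h *: (1 : R)) - flat_exp m 0 : R)) @ 0^' --> (0 : R).
    apply/cvgr0Pnorm_le => eps eps0.
    have f0 : 0 < (m.+2)`!%:R :> R by rewrite ltr0n fact_gt0.
    near=> h.
    have hn0 : h != 0 by near: h; exact: nbhs_dnbhs_neq.
    rewrite /= addr0 (flat_exp_le0 m (lexx 0)) subr0 {1}/GRing.scale /= /GRing.scale /= mulr1.
    rewrite flat_expM mulrCA mulVf // mulr1 ger0_norm ?flat_exp_ge0 //.
    apply: le_trans (flat_exp_bound _ _) _.
    rewrite mulrC -ler_pdivlMr //.
    near: h; apply: dnbhs0_le; exact: divr_gt0.
  by split; [apply/cvg_ex; exists 0 | exact: cvg_lim cv].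
Unshelve. all: by end_near. Qed.

Lemma Ck_flat_exp k m : Ck_on k setT (flat_exp m).
Proof.
elim: k m => [|k IH] m.
  move=> x _; apply: differentiable_continuous.
  by have [] := is_diff_flat_exp m x.
apply: (Ck_onS_is_diff (df := fun t v : R^o => v * flat_exp' m t : R^o) openT).
  by move=> x _; exact: is_diff_flat_exp.
move=> v; apply: (CkZ (g := flat_exp' m)) openT _ _; first exact/Ck_cst/openT.
apply: CkD openT _ _ => //; apply: (CkZ (g := flat_exp _)) openT _ _ => //.
exact/Ck_cst/openT.
Qed.

(** The denominator never vanishes, since t or 1 - t is positive. *)
Definition smooth_step (t : R^o) : R^o :=
  (flat_exp 0 t + flat_exp 0 (1 - t))^-1 *: flat_exp 0 t.

Lemma smooth_step_le0 (t : R) : t <= 0 -> smooth_step t = 0.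
Proof. by move=> t0; rewrite /smooth_step (flat_exp_le0 _ t0) scaler0. Qed.

Lemma smooth_step_ge1 (t : R) : 1 <= t -> smooth_step t = 1.
Proof.
move=> t1; rewrite /smooth_step (flat_exp_le0 _ (t := 1 - t)) ?subr_le0// addr0.
by rewrite /GRing.scale /= mulVf// gt_eqF// flat_exp_gt0// (lt_le_trans _ t1).
Qed.

Lemma smooth_smooth_step : smooth_on setT smooth_step.
Proof.
move=> k; apply: CkZ openT _ _; last exact: Ck_flat_exp.
have c1 : Ck_on k setT (fun t : R^o => flat_exp 0 (1 - t)).
  apply: (Ck_comp (U' := setT) (fin_coords_scalar R)) openT openT _ _ _ => //.
    apply: CkD openT _ _; first exact/Ck_cst/openT.
    apply: (Ck_linear k _ openT (L := -%R : {linear R^o -> R^o})).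
    by move=> x; apply: opp_continuous.
  exact: Ck_flat_exp.
apply: CkV openT _ _ => [x _|].
  have := flat_exp_ge0 0 x; have := flat_exp_ge0 0 (1 - x).
  have : 0 < flat_exp 0 x \/ 0 < flat_exp 0 (1 - x).
    case: (ltP 0 x) => x0; [left|right]; apply: flat_exp_gt0 => //.
    by rewrite subr_gt0 (le_lt_trans x0).
  by move=> [] ? ? ?; rewrite gt_eqF //; [apply: ltr_wpDr|apply: ltr_wpDl].
by apply: CkD openT _ _; [exact: Ck_flat_exp|].
Qed.

End FlatExp.

Section Bump.
Variable R : realType.

Definition plateau (t : R^o) : R^o :=
  smooth_step (2 - t) *: smooth_step (2 + t).

Lemma smooth_plateau : smooth_on setT plateau.
Proof.
move=> k.
have comp (f : R^o -> R^o) : Ck_on k setT f ->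
    Ck_on k setT (fun t => smooth_step (f t)).
  move=> cf; apply: (Ck_comp (U' := setT) (fin_coords_scalar R)) openT openT _ cf _ => //.
  exact: smooth_smooth_step.
have cid : Ck_on k setT (fun t : R^o => t).
  by apply: (Ck_linear k _ openT (L := idfun : {linear R^o -> R^o})) => x.
apply: CkZ openT _ _; apply: comp; apply: CkD openT _ _; try exact/Ck_cst/openT.
  apply: (Ck_linear_comp (L := -%R : {linear R^o -> R^o})) openT cid => //.
  by move=> x; apply: opp_continuous.
exact: cid.
Qed.

Lemma plateau_eq1 (t : R) : `|t| <= 1 -> plateau t = 1.
Proof.
rewrite ler_norml => /andP[t1 t2].
by rewrite /plateau !smooth_step_ge1 ?scale1r //; lra.
Qed.

Lemma plateau_eq0 (t : R) : 2 <= `|t| -> plateau t = 0.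
Proof.
rewrite ler_normr => /orP[] h; rewrite /plateau.
  by rewrite smooth_step_le0 ?scale0r // subr_le0.
by rewrite [smooth_step (2 + t)]smooth_step_le0 ?scaler0 //; lra.
Qed.

Lemma Ck_prod (V : normedModType R) k (U : set V) n (f : 'I_n -> V -> R^o) :
  open U -> (forall i, Ck_on k U (f i)) ->
  Ck_on k U (fun x => \prod_i f i x : R^o).
Proof.
move=> oU; elim: n f => [|n IH] f cf.
  by apply: (Ck_on_eq (f := fun _ => 1 : R^o)) => // [x _|]; [rewrite big_ord0|exact: Ck_cst].
apply: (Ck_on_eq (f := fun x => f ord0 x *: (\prod_i f (lift ord0 i) x : R^o))) => //.
  by move=> x _; rewrite big_ord_recl.
by apply: CkZ => //; apply: IH.
Qed.

(** A product of one-dimensional plateaus gives a function equal to 1 on a small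
cube and supported in a larger cube that is still contained in [A]. *)
Lemma bump_exists n (A : set 'rV[R]_n) (y0 : 'rV[R]_n) : open A -> A y0 ->
  exists (theta : 'rV[R]_n -> R^o) (U K : set 'rV[R]_n),
  [/\ smooth_on setT theta, open U /\ U y0, compact K /\ K `<=` A,
      forall y, U y -> theta y = 1 & forall y, ~ K y -> theta y = 0].
Proof.
move=> oA Ay0.
have /nbhs_ballP[e /= e0 eA] : nbhs y0 A by exact: open_nbhs_nbhs.
(* The support is a cube of half-side 2 d, to be contained in the ball of radius e. *)
pose d := e / 4; have d0 : 0 < d by rewrite divr_gt0.
pose s (k : 'I_n) (y : 'rV[R]_n) : R^o :=
  (d^-1 : R^o) *: (rv_coord k y + - rv_coord k y0).
have sE k y : `|s k y| = `|y ord0 k - y0 ord0 k| / d.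
  by rewrite /s normrZ gtr0_norm ?invr_gt0 // mulrC.
exists (fun y => \prod_k plateau (s k y)), (ball y0 d)°,
  [set y | forall k, `[y0 ord0 k - 2 * d, y0 ord0 k + 2 * d]%classic (y ord0 k)].
split.
- move=> m; apply: Ck_prod openT _ => k.
  apply: (Ck_comp (U' := setT) (fin_coords_scalar R)) openT openT _ _ _ => //;
    last exact: smooth_plateau.
  apply: CkZ openT _ _; first exact/Ck_cst/openT.
  apply: CkD openT _ _; last exact/Ck_cst/openT.
  by apply: Ck_linear openT; exact: rv_coord_continuous.
- by split; [exact: open_interior | apply: nbhsx_ballx].
- split.
    by apply: (@rV_compact _ _ (fun k => `[y0 ord0 k - 2 * d, y0 ord0 k + 2 * d]%classic)) => k;
      exact: segment_compact.
  move=> y Ky; apply: eA; split=> // i j; rewrite ord1 /ball /=.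
  have := Ky j; rewrite /= in_itv /= => /andP[h1 h2].
  have e2 : 2 * d < e by rewrite /d; lra.
  by rewrite ltr_norml; apply/andP; split; lra.
- move=> y /interior_subset [_ yd]; apply: big1 => k _; apply: plateau_eq1.
  rewrite sE ler_pdivrMr // mul1r distrC; apply: ltW; exact: (yd ord0 k).
- move=> y nK.
  have [k hk] : exists k, 2 <= `|s k y|.
    apply: contrapT => h; apply: nK => k; rewrite /= in_itv /=.
    have : `|s k y| < 2 by rewrite ltNge; apply/negP => h'; apply: h; exists k.
    rewrite sE ltr_pdivrMr // ltr_norml => /andP[h1 h2].
    by apply/andP; split; lra.
  by rewrite (bigD1 k) //= plateau_eq0 // mul0r.
Qed.

End Bump.

(** * Differentials of maps between row vectors *)

Section SmoothMore.
Variable R : realType.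

Lemma smooth_differentiable (V W : normedModType R) (U : set V) (f : V -> W) x :
  smooth_on U f -> U x -> differentiable f x.
Proof. by move=> /(_ 1%N) [+ _]; apply. Qed.

(** The differential is linear in the vector, so it suffices to know it on the
standard basis, where [smooth_on] controls it. *)
Lemma Ck_diff_apply (V Z : normedModType R) n k (U : set V) (U' : set 'rV[R]_n)
    (f : 'rV[R]_n -> Z) (h w : V -> 'rV[R]_n) : open U -> open U' ->
  (forall x, U x -> U' (h x)) -> smooth_on U' f -> Ck_on k U h -> Ck_on k U w ->
  Ck_on k U (fun x => 'd f (h x) (w x)).
Proof.
move=> oU oU' UU' cf ch cw.
apply: (Ck_on_eq (f := fun x =>
    \sum_j rv_coord j (w x) *: 'd f (h x) (rv_basis R j))) => //.
  by move=> x _; rewrite -linear_rv_sum.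
apply: Ck_sum => // j; apply: CkZ => //.
  by apply: Ck_linear_comp => //; exact: rv_coord_continuous.
have [_ /(_ (rv_basis R j)) cfj] := cf k.+1.
exact: (Ck_comp (fin_coords_rV R n) oU oU' UU' ch cfj).
Qed.

Lemma Ck_row_mx (V : normedModType R) n m k (U : set V)
    (f : V -> 'rV[R]_n) (g : V -> 'rV[R]_m) : open U -> Ck_on k U f ->
  Ck_on k U g -> Ck_on k U (fun x => row_mx (f x) (g x)).
Proof.
move=> oU cf cg.
apply: (Ck_on_eq (f := fun x => mulmxr (row_mx 1%:M 0) (f x) +
                              mulmxr (row_mx 0 1%:M) (g x))) => //.
  move=> x _; rewrite /= !mul_mx_row !mulmx1 !mulmx0 add_row_mx.
  by rewrite addr0 add0r.
by apply: CkD => //; apply: Ck_linear_comp => //; exact: linear_rV_continuous.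
Qed.

Lemma Ck_lsubmx (V : normedModType R) n m k (U : set V)
    (f : V -> 'rV[R]_(n + m)) : open U -> Ck_on k U f ->
  Ck_on k U (fun x => lsubmx (f x)).
Proof.
by move=> oU cf; apply: Ck_linear_comp => //; exact: linear_rV_continuous.
Qed.

Lemma Ck_rsubmx (V : normedModType R) n m k (U : set V)
    (f : V -> 'rV[R]_(n + m)) : open U -> Ck_on k U f ->
  Ck_on k U (fun x => rsubmx (f x)).
Proof.
by move=> oU cf; apply: Ck_linear_comp => //; exact: linear_rV_continuous.
Qed.

Lemma Ck_id (V : normedModType R) k (U : set V) : open U ->
  Ck_on k U (fun x : V => x).
Proof.
by move=> oU; apply: (Ck_linear k (L := idfun : {linear V -> V})) => // x.
Qed.

(** The differential is the directional derivative, which is immediate along a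
line on which the map is affine. *)
Lemma diff_affine_line (V W : normedModType R) (f : V -> W) (y v : V) (w : W) :
  differentiable f y -> (forall h : R, f (h *: v + y) = f y + h *: w) ->
  'd f y v = w.
Proof.
move=> df fh; rewrite -deriveE //; apply/lim_near_cst => //=.
near=> h; have hn0 : h != 0 by near: h; exact: nbhs_dnbhs_neq.
by rewrite fh addrC addKr scalerA mulVf // scale1r.
Unshelve. all: by end_near. Qed.

Lemma is_diff_row_mx (V : normedModType R) (m l : nat) (f : V -> 'rV[R]_m)
    (g : V -> 'rV[R]_l) df dg (x : V) : is_diff x f df -> is_diff x g dg ->
  is_diff x (fun y => row_mx (f y) (g y)) (fun v => row_mx (df v) (dg v)).
Proof.
move=> fx gx.
pose Lf := mulmxr (row_mx 1%:M 0) : {linear 'rV[R]_m -> 'rV[R]_(m + l)}.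
pose Lg := mulmxr (row_mx 0 1%:M) : {linear 'rV[R]_l -> 'rV[R]_(m + l)}.
have E u v : row_mx u v = Lf u + Lg v.
  by rewrite /= !mul_mx_row !mulmx1 !mulmx0 add_row_mx addr0 add0r.
have dL q (L : {linear 'rV[R]_q -> 'rV[R]_(m + l)}) (z : 'rV[R]_q) : is_diff z L L.
  have c : continuous L by exact: linear_rV_continuous.
  by split; [exact: linear_differentiable | exact: diff_lin].
have := is_diffD (is_diff_comp fx (dL _ Lf (f x))) (is_diff_comp gx (dL _ Lg (g x))).
by congr is_diff_def; apply/funext => y; rewrite E.
Qed.

End SmoothMore.

(** * Changes of coordinates on the tangent spaces *)

Section Charts.
Variables (R : realType) (n : nat) (M : atlas R n).
Hypothesis hM : is_manifold M.
Implicit Types (i j k : chart_index M) (x : M).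

Definition overlap i j := chart M i @` (dom M i `&` dom M j).
Definition trans i j : 'rV[R]_n -> 'rV[R]_n := chart M j \o cochart M i.

Lemma overlap_open i j : open (overlap i j). Proof. exact: mfd_overlap. Qed.
Lemma trans_smooth i j : smooth_on (overlap i j) (trans i j).
Proof. exact: mfd_transition. Qed.

Lemma overlap_chart i j x : dom M i x -> dom M j x -> overlap i j (chart M i x).
Proof. by move=> ix jx; exists x. Qed.

Lemma chart_rangeE i : chart_range i = overlap i i.
Proof. by rewrite /overlap setIid. Qed.

Lemma chart_range_open i : open (chart_range i).
Proof. by rewrite chart_rangeE; exact: overlap_open. Qed.

Lemma chart_range_chart i x : dom M i x -> chart_range i (chart M i x).
Proof. by exists x. Qed.

Lemma chart_range_dom i y : chart_range i y -> dom M i (cochart M i y).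
Proof. by move=> [x ix <-]; rewrite mfd_chartK. Qed.

Lemma cochartK i y : chart_range i y -> chart M i (cochart M i y) = y.
Proof. by move=> [x ix <-]; rewrite mfd_chartK. Qed.

Lemma overlapP i j y :
  overlap i j y <-> chart_range i y /\ dom M j (cochart M i y).
Proof.
split=> [[x [ix jx] <-]|[iy jy]].
  by rewrite mfd_chartK //; split=> //; exact: chart_range_chart.
by exists (cochart M i y); [split=> //; exact: chart_range_dom | exact: cochartK].
Qed.

Lemma overlap_trans i j y : overlap i j y -> overlap j i (trans i j y).
Proof.
by move=> [x [ix jx] <-]; exists x; [split|rewrite /trans /= mfd_chartK].
Qed.

Lemma trans_chart i j x : dom M i x -> trans i j (chart M i x) = chart M j x.
Proof. by move=> ix; rewrite /trans /= mfd_chartK. Qed.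

Lemma trans_differentiable i j x : dom M i x -> dom M j x ->
  differentiable (trans i j) (chart M i x).
Proof.
move=> ix jx; apply: smooth_differentiable (@trans_smooth i j) _.
exact: overlap_chart.
Qed.

Section Change.
Variables (Z : normedModType R) (F : M -> Z) (i j : chart_index M) (x : M).
Hypotheses (ix : dom M i x) (jx : dom M j x).
Hypothesis dF : differentiable (F \o cochart M j) (chart M j x).

(** The chain rule that all changes of charts below reduce to: near the point, the
expression of [F] in the chart [i] is its expression in the chart [j] composed
with the transition map. *)
Lemma is_diff_change : is_diff (chart M i x) (F \o cochart M i)
  ('d (F \o cochart M j) (chart M j x) \o 'd (trans i j) (chart M i x)).
Proof.
have dF' : differentiable (F \o cochart M j) (trans i j (chart M i x)).
  by rewrite trans_chart.
have := is_diff_comp (differentiableP (trans_differentiable ix jx))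
  (differentiableP dF').
rewrite trans_chart //.
apply: (eq_on_is_diff (@overlap_open i j)); first exact: overlap_chart.
by move=> y; rewrite inE => -[z [iz jz] <-] /=; rewrite trans_chart ?mfd_chartK.
Qed.

Lemma diff_change v : 'd (F \o cochart M i) (chart M i x) v =
  'd (F \o cochart M j) (chart M j x) ('d (trans i j) (chart M i x) v).
Proof. by have [_ e] := is_diff_change; exact: (congr1 (fun f : 'rV[R]_n -> Z => f v) e). Qed.

End Change.

Lemma trans_id_diff i x v : dom M i x -> 'd (trans i i) (chart M i x) v = v.
Proof.
move=> ix.
have idE : {in chart_range i, id =1 trans i i}.
  by move=> y; rewrite inE /trans /= => /cochartK ->.
have [_ e] := eq_on_is_diff (@chart_range_open i) (chart_range_chart ix) idE
  (is_diff_id _).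
exact: (congr1 (fun f : 'rV[R]_n -> 'rV[R]_n => f v) e).
Qed.

(** The cocycle rule for tangent coordinates; it makes [to_coords] and [of_coords]
inverse to each other and independent of the preferred chart. *)
Lemma trans_diff_comp i j k x v : dom M i x -> dom M j x -> dom M k x ->
  'd (trans j k) (chart M j x) ('d (trans i j) (chart M i x) v) =
  'd (trans i k) (chart M i x) v.
Proof.
move=> ix jx kx.
exact: (esym (diff_change ix jx (trans_differentiable jx kx) v)).
Qed.

HB.instance Definition _ i x := GRing.Linear.copy (to_coords i x)
  ('d (trans (pref M x) i) (chart M (pref M x) x)).
HB.instance Definition _ i x := GRing.Linear.copy (of_coords i x)
  ('d (trans i (pref M x)) (chart M i x)).

Lemma to_of_coords i j x w : dom M i x -> dom M j x ->
  to_coords j x (of_coords i x w) = 'd (trans i j) (chart M i x) w.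
Proof. by move=> ix jx; apply: trans_diff_comp => //; exact: mfd_pref. Qed.

Lemma to_coords_trans i j x v : dom M i x -> dom M j x ->
  'd (trans i j) (chart M i x) (to_coords i x v) = to_coords j x v.
Proof. by move=> ix jx; apply: trans_diff_comp => //; exact: mfd_pref. Qed.

Lemma of_coordsK i x w : dom M i x -> to_coords i x (of_coords i x w) = w.
Proof. by move=> ix; rewrite to_of_coords // trans_id_diff. Qed.

Lemma to_coordsK i x v : dom M i x -> of_coords i x (to_coords i x v) = v.
Proof.
move=> ix; have px := mfd_pref hM x.
by rewrite /of_coords to_coords_trans // /to_coords trans_id_diff.
Qed.

Lemma to_coords_pref x v : to_coords (pref M x) x v = v.
Proof. exact/trans_id_diff/mfd_pref. Qed.

End Charts.

(** * The tangent bundle is a manifold *)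

Section TangentBundle.
Variables (R : realType) (n : nat) (M : atlas R n).
Hypothesis hM : is_manifold M.
Notation TM := (tangent_bundle M).
Implicit Types (i j k : chart_index M) (x : M) (a : TM).

(** The image of a set under a chart of TM is read off the inverse chart; every
fibre is attained because [to_coords] is surjective. *)
Lemma tm_chart_image i (P : set TM) y :
  (chart TM i @` (P `&` dom TM i)) y <->
  chart_range i (lsubmx y) /\ P (cochart TM i y).
Proof.
split=> [[a [Pa /= ia] <-]|[iy Py]].
  rewrite row_mxKl row_mxKr mfd_chartK // to_coordsK //.
  by split; [exact: chart_range_chart|case: a Pa {ia}].
exists (cochart TM i y); first by split=> //; exact: (chart_range_dom hM iy).
have ix := chart_range_dom hM iy.
by rewrite /= of_coordsK // cochartK // hsubmxK.
Qed.

Lemma tm_chart_rangeE i : @chart_range R (n + n) TM i = lsubmx @^-1` (chart_range i).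
Proof.
apply/seteqP; split=> y.
  by rewrite /chart_range -(setTI (dom TM i)) => /tm_chart_image[].
by move=> iy; rewrite /chart_range -(setTI (dom TM i)); apply/tm_chart_image.
Qed.

Lemma tm_overlapE i j : @overlap R (n + n) TM i j = lsubmx @^-1` (overlap i j).
Proof.
apply/seteqP; split=> y.
  by rewrite /overlap setIC => /tm_chart_image[iy jy]; apply/overlapP.
move=> /(overlapP hM)[iy jy]; rewrite /overlap setIC.
by apply/tm_chart_image; split.
Qed.

Lemma lsubmx_open (A : set 'rV[R]_n) :
  open A -> open ((lsubmx : 'rV[R]_(n + n) -> 'rV[R]_n) @^-1` A).
Proof. by move=> oA; apply: open_comp => // y _; exact: continuous_lsubmx. Qed.

(** The transition maps of TM are the tangent maps of those of M. *)
Lemma tm_transE i j y : overlap i j (lsubmx y) ->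
  trans (M := TM) i j y =
  row_mx (trans i j (lsubmx y)) ('d (trans i j) (lsubmx y) (rsubmx y)).
Proof.
move=> /(overlapP hM)[iy jy]; rewrite /trans /=; congr row_mx.
have ix := chart_range_dom hM iy.
by rewrite (to_of_coords hM _ ix jy) (cochartK hM iy).
Qed.

Lemma tm_trans_smooth i j :
  smooth_on (lsubmx @^-1` (overlap i j)) (trans (M := TM) i j).
Proof.
move=> k; have oo := lsubmx_open (overlap_open hM (i := i) (j := j)).
apply: (Ck_on_eq oo (f := fun y => row_mx (trans i j (lsubmx y))
   ('d (trans i j) (lsubmx y) (rsubmx y)))).
  by move=> y; rewrite inE => iy; rewrite tm_transE.
have cl := Ck_lsubmx oo (Ck_id k oo).
have cr := Ck_rsubmx oo (Ck_id k oo).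
apply: Ck_row_mx => //.
  apply: (Ck_comp (fin_coords_rV R n) oo (overlap_open hM (i:=i) (j:=j)) _ cl) => //.
  exact: trans_smooth.
by apply: (Ck_diff_apply (U' := overlap i j)) => //;
  [exact: overlap_open|exact: trans_smooth].
Qed.

Lemma tm_open_proj (A : set M) : mfd_open A -> mfd_open (fst @^-1` A : set TM).
Proof.
move=> oA i.
have -> : chart TM i @` ((fst @^-1` A : set TM) `&` dom TM i) =
    lsubmx @^-1` (chart M i @` (A `&` dom M i)).
  apply/seteqP; split=> y.
    move=> /tm_chart_image[iy /= Ay]; exists (cochart M i (lsubmx y)).
      by split=> //; exact: chart_range_dom.
    exact: cochartK.
  move=> [x [Ax ix] xy]; apply/tm_chart_image.
  by rewrite /= -xy mfd_chartK //; split=> //; exact: chart_range_chart.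
exact: lsubmx_open.
Qed.

(** In the chart [j], such a set is a preimage under the continuous transition map
of TM. Sets of this form separate two vectors tangent at the same point. *)
Lemma tm_open_chart i (B : set 'rV[R]_n) : open B ->
  mfd_open [set a : TM | dom M i a.1 /\ B (to_coords i a.1 a.2)].
Proof.
move=> oB j.
have -> : chart TM j @` ([set a : TM | dom M i a.1 /\ B (to_coords i a.1 a.2)]
      `&` dom TM j) =
    [set y : 'rV[R]_(n + n) | @overlap R n M j i (lsubmx y) /\ B (rsubmx (trans (M := TM) j i y))].
  apply/seteqP; split=> y.
    by move=> /tm_chart_image[jy /= [iy By]]; split; [apply/(overlapP hM)|rewrite row_mxKr].
  move=> /= [/(overlapP hM)[jy iy] By]; apply/tm_chart_image; split=> //; split=> //.
  by move: By; rewrite row_mxKr.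
rewrite openE => y [oy By].
have oo := lsubmx_open (@overlap_open R n M hM j i).
have h1 := open_nbhs_nbhs (conj oo oy).
have ct : {for y, continuous (fun z => rsubmx (trans (M := TM) j i z) : 'rV[R]_n)}.
  apply: (continuous_comp (f := trans (M := TM) j i)); last exact: continuous_rsubmx.
  exact: (@tm_trans_smooth j i 0%N).
have h2 := ct _ (open_nbhs_nbhs (conj oB By)).
by apply: filterS (filterI h1 h2) => z [].
Qed.

(** Vectors over distinct points are separated by open sets of M, vectors over the
same point by open sets of a fibre in a chart. *)
Lemma tangent_bundle_manifold : is_manifold TM.
Proof.
split.
- by move=> a; exact: (mfd_pref hM a.1).
- move=> i [x v] /= ix.
  by rewrite row_mxKl row_mxKr mfd_chartK // to_coordsK.
- move=> i j; have := tm_overlapE i j; rewrite /overlap => ->.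
  exact/lsubmx_open/overlap_open.
- move=> i j; have := tm_overlapE i j; rewrite {1}/overlap => ->.
  exact: tm_trans_smooth.
- move=> a b ab; have [e|ne] := pselect (a.1 = b.1).
    have ne2 : a.2 <> b.2.
      by move=> e2; apply: ab; case: a b e e2 => ? ? [? ?] /= -> ->.
    have := @norm_hausdorff R 'rV[R]_n; rewrite open_hausdorff => /(_ a.2 b.2).
    move=> /(_ (introN eqP ne2)) [[A B] /= [Aa Bb] [oA oB AB]].
    pose p := pref M a.1.
    exists [set c : TM | dom M p c.1 /\ A (to_coords p c.1 c.2)],
      [set c : TM | dom M p c.1 /\ B (to_coords p c.1 c.2)]; split.
    + exact: tm_open_chart.
    + exact: tm_open_chart.
    + by rewrite /= to_coords_pref //; split; [exact: (mfd_pref hM)|exact/set_mem].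
    + rewrite /= /p e to_coords_pref //.
      by split; [exact: (mfd_pref hM)|exact/set_mem].
    + apply/seteqP; split=> // c [[_ Ac] [_ Bc]].
      by move: AB => /eqP/seteqP[/(_ (to_coords p c.1 c.2))/(_ (conj Ac Bc))].
  have [A [B [oA oB Aa Bb AB]]] := mfd_hausdorff hM ne.
  exists (fst @^-1` A), (fst @^-1` B); split=> //; try exact: tm_open_proj.
  by rewrite -preimage_setI AB preimage_set0.
- have [I cI Icov] := mfd_countable hM.
  by exists I => // a; exact: Icov.
Qed.

End TangentBundle.

(** * Extension by zero of compactly supported data *)

Section ZeroExtension.
Variables (R : realType) (n : nat) (M : atlas R n).
Hypothesis hM : is_manifold M.
Implicit Types (i j k : chart_index M) (x : M).

(** A compact subset of a chart is closed in M. Each of its points is separated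
from [x], and compactness makes the neighbourhood of [x] uniform. This is where
the Hausdorff property enters. *)
Lemma compact_avoid i j (K : set 'rV[R]_n) x :
  compact K -> K `<=` chart_range i -> dom M j x -> ~ dom M i x ->
  \forall y \near chart M j x,
    ~ (dom M i (cochart M j y) /\ K (chart M i (cochart M j y))).
Proof.
move=> /compact_near_coveringP cK KA jx nix.
pose P (y z : 'rV[R]_n) :=
  ~ (dom M i (cochart M j y) /\ chart M i (cochart M j y) = z).
have h : \forall y \near chart M j x, K `<=` P y.
  apply: (cK 'rV[R]_n (nbhs (chart M j x)) P _) => z Kz.
  have iz := KA z Kz.
  have ne : x <> cochart M i z.
    by move=> e; apply: nix; rewrite e; exact: (chart_range_dom hM).
  have [A [B [oA oB Ax Bz AB]]] := mfd_hausdorff hM ne.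
  exists (chart M i @` (B `&` dom M i), chart M j @` (A `&` dom M j)) => /=.
    split; apply: open_nbhs_nbhs; split.
    - exact: oB.
    - exists (cochart M i z); last exact: (cochartK hM).
      by split=> //; exact: (chart_range_dom hM).
    - exact: oA.
    - by exists x.
  move=> [z' y] /= [[b [Bb ib] bz] [a [Aa ja] ay]].
  rewrite /P /= -ay mfd_chartK // -bz => -[ia e].
  have ab : a = b by rewrite -(mfd_chartK hM ia) e mfd_chartK.
  have : (A `&` B) a by split=> //; rewrite ab.
  by rewrite AB.
by apply: filterS h => y h [iy Ky]; exact: (h _ Ky).
Qed.

(** A point of the chart [j] either lies in the chart [i], where [g] is the smooth
[h], or has a neighbourhood avoiding the support, where [g] vanishes. *)
Lemma smooth_on_patch (Z : normedModType R) i j (K : set 'rV[R]_n)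
    (g h : 'rV[R]_n -> Z) : compact K -> K `<=` chart_range i ->
  smooth_on (overlap j i) h -> {in overlap j i, h =1 g} ->
  (forall y, chart_range j y ->
     ~ (dom M i (cochart M j y) /\ K (chart M i (cochart M j y))) -> g y = 0) ->
  smooth_on (chart_range j) g.
Proof.
move=> cK KA sh hg g0 k; apply: Ck_on_local => y jy.
have [iy|niy] := pselect (dom M i (cochart M j y)).
  exists (overlap j i); first exact/(overlapP hM).
  exact: Ck_on_eq (overlap_open hM (i := j) (j := i)) hg (sh k).
have := compact_avoid cK KA (chart_range_dom hM jy) niy.
rewrite (cochartK hM) // -nbhs_nearE nbhsE => -[B [oB By] Bav].
have oBj : open (B `&` chart_range j).
  by apply: openI => //; exact: (chart_range_open hM).
exists (B `&` chart_range j) => //.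
apply: (Ck_on_eq oBj (f := fun _ => 0)); last exact: Ck_cst.
by move=> z; rewrite inE => -[Bz jz]; rewrite g0 //; exact: Bav.
Qed.

Definition field_coords i (X : M -> 'rV[R]_n) (y : 'rV[R]_n) : 'rV[R]_n :=
  to_coords i (cochart M i y) (X (cochart M i y)).

Definition ext_field i (F : 'rV[R]_n -> 'rV[R]_n) x : 'rV[R]_n :=
  if `[< dom M i x >] then of_coords i x (F (chart M i x)) else 0.

Definition ext_fun i (f : 'rV[R]_n -> R^o) x : R :=
  if `[< dom M i x >] then f (chart M i x) else 0.

Lemma ext_fieldE i F x : dom M i x -> ext_field i F x = of_coords i x (F (chart M i x)).
Proof. by move=> ix; rewrite /ext_field; case: asboolP. Qed.

Lemma ext_funE i f x : dom M i x -> ext_fun i f x = f (chart M i x).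
Proof. by move=> ix; rewrite /ext_fun; case: asboolP. Qed.

Lemma smooth_ext_field i (K : set 'rV[R]_n) F :
  compact K -> K `<=` chart_range i -> smooth_on (chart_range i) F ->
  (forall y, ~ K y -> F y = 0) -> smooth_field (ext_field i F).
Proof.
move=> cK KA sF F0 j.
apply: (smooth_on_patch (i := i) (K := K)
  (h := fun y => 'd (trans i j) (trans j i y) (F (trans j i y)))) => //.
- move=> k; have oo := overlap_open hM (i := j) (j := i).
  have ct := @trans_smooth R n M hM j i k.
  apply: (Ck_diff_apply (U' := overlap i j)) => //.
  + exact: (overlap_open hM).
  + by move=> y; exact: (overlap_trans hM).
  + exact: (trans_smooth hM).
  + apply: (Ck_comp (fin_coords_rV R n) oo (chart_range_open hM (i := i)) _ ct (sF k)).
    by move=> y /(overlap_trans hM) /(overlapP hM)[].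
- move=> y; rewrite inE => -[x [jx ix] <-] /=.
  rewrite mfd_chartK // ext_fieldE // (to_of_coords hM _ ix jx).
  by rewrite (trans_chart hM i jx).
- move=> y jy nK; rewrite /ext_field; case: asboolP => iy; last by rewrite linear0.
  by rewrite F0 ?linear0 // => Ky; apply: nK.
Qed.

Lemma smooth_ext_fun i (K : set 'rV[R]_n) f :
  compact K -> K `<=` chart_range i -> smooth_on (chart_range i) f ->
  (forall y, ~ K y -> f y = 0) -> smooth_fun (ext_fun i f).
Proof.
move=> cK KA sf f0 j.
apply: (smooth_on_patch (i := i) (K := K) (h := fun y => f (trans j i y))) => //.
- move=> k; have oo := overlap_open hM (i := j) (j := i).
  have ct := @trans_smooth R n M hM j i k.
  apply: (Ck_comp (fin_coords_rV R n) oo (chart_range_open hM (i := i)) _ ct (sf k)).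
  by move=> y /(overlap_trans hM) /(overlapP hM)[].
- move=> y; rewrite inE => -[x [jx ix] <-] /=.
  by rewrite mfd_chartK // ext_funE // (trans_chart hM i jx).
- move=> y jy nK; rewrite /ext_fun /=; case: asboolP => // iy.
  by rewrite f0 // => Ky; apply: nK.
Qed.

Lemma smooth_fieldZ (f : M -> R) X :
  smooth_fun f -> smooth_field X -> smooth_field (fun z => f z *: X z).
Proof.
move=> sf sX i k; apply: (Ck_on_eq (chart_range_open hM (i := i))
  (f := fun y => ((f \o cochart M i) y : R^o) *: field_coords i X y)).
  by move=> y _; rewrite /field_coords /= linearZ.
by apply: CkZ; [exact: (chart_range_open hM)|exact: sf|exact: sX].
Qed.

Lemma smooth_field_sum m (X : 'I_m -> M -> 'rV[R]_n) :
  (forall l, smooth_field (X l)) -> smooth_field (fun z => \sum_l X l z).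
Proof.
move=> sX i k; apply: (Ck_on_eq (chart_range_open hM (i := i))
  (f := fun y => \sum_l field_coords i (X l) y)).
  by move=> y _; rewrite /field_coords /= linear_sum.
by apply: Ck_sum => [|l]; [exact: (chart_range_open hM)|exact: sX].
Qed.

Lemma smooth_fun_cst (c : R) : smooth_fun (fun _ : M => c).
Proof. by move=> i k; apply: Ck_cst; exact: (chart_range_open hM). Qed.

Lemma dfun_coords (f : M -> R) i x v : smooth_fun f -> dom M i x ->
  dfun f x v = 'd (f \o cochart M i : _ -> R^o) (chart M i x) (to_coords i x v).
Proof.
move=> sf ix; have px := mfd_pref hM x.
apply: (diff_change (Z := R^o) (F := f) hM px ix).
by apply: smooth_differentiable (sf i) _; exact: chart_range_chart.
Qed.

End ZeroExtension.

(** * Connections in a chart *)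

Section Connection.
Variables (R : realType) (n : nat) (M : atlas R n).
Hypothesis hM : is_manifold M.
Variable D : (M -> 'rV[R]_n) -> (M -> 'rV[R]_n) -> M -> 'rV[R]_n.
Hypothesis hD : linear_connection D.
Implicit Types (i j k : chart_index M) (x : M).

Lemma conn_suml m (f : 'I_m -> M -> R) (X : 'I_m -> M -> 'rV[R]_n) Y x :
  (forall l, smooth_fun (f l)) -> (forall l, smooth_field (X l)) ->
  smooth_field Y ->
  D (fun z => \sum_l f l z *: X l z) Y x = \sum_l f l x *: D (X l) Y x.
Proof.
move=> sf sX sY; have sfX l := smooth_fieldZ hM (sf l) (sX l).
elim: m f X sf sX sfX => [|m IH] f X sf sX sfX.
  rewrite big_ord0.
  have -> : (fun z => \sum_(l < 0) f l z *: X l z) = fun z => (0 : R) *: Y z.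
    by apply/funext => z; rewrite big_ord0 scale0r.
  by rewrite (conn_scalel hD (smooth_fun_cst hM 0)) // scale0r.
have -> : (fun z => \sum_l f l z *: X l z) = fun z =>
    f ord0 z *: X ord0 z + \sum_(l < m) f (lift ord0 l) z *: X (lift ord0 l) z.
  by apply/funext => z; rewrite big_ord_recl.
rewrite (conn_addl hD) //; last by apply: smooth_field_sum.
by rewrite (conn_scalel hD) // IH // big_ord_recl.
Qed.

(** The Leibniz rule for a combination with function coefficients; the empty sum
is the zero field, written 0 times [X] to apply the Leibniz rule. *)
Lemma conn_sumr m (f : 'I_m -> M -> R) (Y : 'I_m -> M -> 'rV[R]_n) X x :
  (forall l, smooth_fun (f l)) -> (forall l, smooth_field (Y l)) ->
  smooth_field X ->
  D X (fun z => \sum_l f l z *: Y l z) x =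
  \sum_l (dfun (f l) x (X x) *: Y l x + f l x *: D X (Y l) x).
Proof.
move=> sf sY sX; have sfY l := smooth_fieldZ hM (sf l) (sY l).
elim: m f Y sf sY sfY => [|m IH] f Y sf sY sfY.
  rewrite big_ord0.
  have -> : (fun z => \sum_(l < 0) f l z *: Y l z) = fun z => (0 : R) *: X z.
    by apply/funext => z; rewrite big_ord0 scale0r.
  rewrite (conn_leibniz hD (smooth_fun_cst hM 0)) // scale0r addr0.
  have -> : dfun (fun _ : M => 0 : R) x (X x) = 0; last by rewrite scale0r.
  have px := mfd_pref hM x.
  rewrite /dfun.
  have -> : ((fun _ : M => 0 : R) \o cochart M (pref M x) : _ -> R^o) = cst 0 by [].
  by rewrite diff_cst.
have -> : (fun z => \sum_l f l z *: Y l z) = fun z =>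
    f ord0 z *: Y ord0 z + \sum_(l < m) f (lift ord0 l) z *: Y (lift ord0 l) z.
  by apply/funext => z; rewrite big_ord_recl.
rewrite (conn_addr hD) //; last by apply: smooth_field_sum.
by rewrite (conn_leibniz hD) // IH // big_ord_recl.
Qed.

(** A connection is an operator on global fields, so its locality is not part of
the data. Let theta be a bump function equal to 1 on [U] and supported in the
chart ([th] below), and let [rho] be its square. The fields [E l], equal to
theta times the coordinate fields, and the functions [c X l], equal to theta
times the components of [X], are global and smooth, and [rho X] is the sum of
the [c X l E l]. At a point of [U] the function [rho] is 1 with zero
differential, so replacing [X] by [rho X] and [Y] by [rho Y] does not change the
value of nabla_X Y, and the axioms of a connection give the classical formula
with the Christoffel symbols nabla_(E l) (E m). *)
Lemma local_frame i x0 : dom M i x0 -> exists (U : set 'rV[R]_n)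
   (E : 'I_n -> M -> 'rV[R]_n),
  [/\ open U /\ U (chart M i x0), U `<=` chart_range i,
      forall l, smooth_field (E l),
      forall x, dom M i x -> U (chart M i x) ->
        forall l, to_coords i x (E l x) = rv_basis R l &
      forall X Y x, smooth_field X -> smooth_field Y -> dom M i x ->
        U (chart M i x) ->
        to_coords i x (D X Y x) =
          'd (field_coords i Y) (chart M i x) (to_coords i x (X x)) +
          \sum_l \sum_m (rv_coord m (to_coords i x (Y x)) *
             rv_coord l (to_coords i x (X x))) *: to_coords i x (D (E l) (E m) x)].
Proof.
move=> ix0; have oA := chart_range_open hM (i := i).
have [th [U [K [sth [oU Ux0] [cK KA] th1 th0]]]] :=
  bump_exists oA (chart_range_chart ix0).
have UK : U `<=` K.
  move=> y Uy; apply: contrapT => nK; have := th1 y Uy.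
  by rewrite th0 // => /esym/eqP; rewrite oner_eq0.
have sth' : smooth_on (chart_range i) th by move=> k; apply: Ck_on_sub (sth k).
pose E l := ext_field i (fun y => th y *: rv_basis R l).
pose c (X : M -> 'rV[R]_n) l := ext_fun i (fun y => th y *: rv_coord l (field_coords i X y)).
pose rho := ext_fun i (fun y => th y *: th y).
have sE l : smooth_field (E l).
  apply: (smooth_ext_field hM cK KA) => [k|y nK]; last by rewrite th0 // scale0r.
  by apply: (CkZ oA (sth' k) (Ck_cst _ _ oA)).
have sc X l : smooth_field X -> smooth_fun (c X l).
  move=> sX; apply: (smooth_ext_fun hM cK KA) => [k|y nK].
    apply: (CkZ oA (sth' k)); apply: (Ck_linear_comp _ oA (sX i k)).
    exact: rv_coord_continuous.
  by rewrite th0 // scale0r.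
have srho : smooth_fun rho.
  apply: (smooth_ext_fun hM cK KA) => [k|y nK]; last by rewrite th0 // scale0r.
  exact: (CkZ oA (sth' k) (sth' k)).
have cE X x : rho x *: X x = \sum_l c X l x *: E l x.
  rewrite /rho /c /E /ext_fun /ext_field; case: asboolP => ix; last first.
    by rewrite scale0r big1 // => l _; rewrite scale0r.
  have repx : field_coords i X (chart M i x) = to_coords i x (X x).
    by rewrite /field_coords mfd_chartK.
  rewrite repx -[X x in LHS](to_coordsK hM _ ix) [to_coords i x (X x) in LHS]rv_sum.
  rewrite linear_sum scaler_sumr; apply: eq_bigr => l _.
  by rewrite !linearZ /= !scalerA; congr (_ *: _); rewrite /GRing.scale /=; ring.
exists U, E; split=> //.
- by move=> y /UK /KA.
- by move=> x ix Ux l; rewrite /E ext_fieldE // th1 // scale1r (of_coordsK hM).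
move=> X Y x sX sY ix Ux; set y := chart M i x in Ux *.
have Ex l : E l x = of_coords i x (rv_basis R l).
  by rewrite /E ext_fieldE // th1 // scale1r.
have rhox : rho x = 1 by rewrite /rho ext_funE // th1 // scale1r.
have cx Z l : c Z l x = rv_coord l (to_coords i x (Z x)).
  by rewrite /c ext_funE // th1 // scale1r /field_coords mfd_chartK.
have near_U (f g : 'rV[R]_n -> R^o) : smooth_on (chart_range i) f ->
    {in U, f =1 g} -> 'd g y = 'd f y :> (_ -> _).
  move=> sf fg; apply: (eq_on_diff oU Ux fg).
  by apply: smooth_differentiable sf _; exact/KA/UK.
have drho v : dfun rho x v = 0.
  rewrite (dfun_coords hM v srho ix).
  have e : {in U, (fun _ => 1 : R^o) =1 (rho \o cochart M i : _ -> R^o)}.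
    move=> z; rewrite inE => Uz; have iz := KA _ (UK _ Uz).
    have dz := chart_range_dom hM iz.
    by rewrite /= /rho ext_funE // (cochartK hM iz) th1 // scale1r.
  rewrite (near_U _ _ _ e); last by move=> k; exact: Ck_cst.
  by rewrite (diff_cst (1 : R^o)).
have dc l v : dfun (c Y l) x v =
    rv_coord l ('d (field_coords i Y) y (to_coords i x v)).
  rewrite (dfun_coords hM v (sc _ _ sY) ix) -/y.
  have e : {in U, (fun z => rv_coord l (field_coords i Y z)) =1
      (c Y l \o cochart M i : _ -> R^o)}.
    move=> z; rewrite inE => Uz; have iz := KA _ (UK _ Uz).
    have dz := chart_range_dom hM iz.
    by rewrite /= /c ext_funE // (cochartK hM iz) th1 // scale1r.
  have sr : smooth_on (chart_range i) (fun z => rv_coord l (field_coords i Y z)).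
    by move=> k; apply: (Ck_linear_comp _ oA (sY i k)); exact: rv_coord_continuous.
  rewrite (near_U _ _ sr e).
  have dY : differentiable (field_coords i Y) y.
    by apply: smooth_differentiable (sY i) _; exact/KA/UK.
  have cl := @rv_coord_continuous R n l.
  rewrite (diff_comp dY (linear_differentiable (field_coords i Y y) cl)) /=.
  by rewrite (diff_lin _ cl).
(* X can be replaced by rho X, since rho is 1 at x. *)
have step X' Y' : smooth_field X' -> smooth_field Y' ->
    D (fun z => rho z *: X' z) Y' x = D X' Y' x.
  by move=> sX' sY'; rewrite (conn_scalel hD) // rhox scale1r.
have DX m : D X (E m) x = \sum_l c X l x *: D (E l) (E m) x.
  rewrite -step // -conn_suml //; last by move=> l; exact: sc.
  by congr (D _ _ x); apply/funext => z; exact: cE.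
(* Y can be replaced by rho Y, since moreover the differential of rho vanishes at x. *)
have -> : D X Y x = \sum_m (dfun (c Y m) x (X x) *: E m x + c Y m x *: D X (E m) x).
  rewrite -conn_sumr //; last by move=> l; exact: sc.
  have -> : (fun z => \sum_l c Y l z *: E l z) = fun z => rho z *: Y z.
    by apply/funext => z; rewrite cE.
  by rewrite (conn_leibniz hD) // drho scale0r add0r rhox scale1r.
rewrite big_split linearD /=; congr (_ + _).
  rewrite [RHS]rv_sum linear_sum; apply: eq_bigr => l _.
  by rewrite linearZ /= Ex (of_coordsK hM _ ix) dc.
rewrite exchange_big linear_sum; apply: eq_bigr => m _ /=.
rewrite DX linearZ /= linear_sum scaler_sumr; apply: eq_bigr => l _.
by rewrite linearZ /= scalerA !cx.
Qed.

Lemma smooth_field_through x (v : 'rV[R]_n) :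
  exists2 X : M -> 'rV[R]_n, smooth_field X & X x = v.
Proof.
have px := mfd_pref hM x.
have [U [E [[_ Ux] _ sE Ex _]]] := local_frame px.
exists (fun z => \sum_l (fun _ => rv_coord l v) z *: E l z).
  apply: (smooth_field_sum hM (X := fun l z => (fun _ => rv_coord l v) z *: E l z)) => l.
  exact: (smooth_fieldZ hM (smooth_fun_cst hM _)).
rewrite [RHS]rv_sum; apply: eq_bigr => l _ /=; congr (_ *: _).
by rewrite -[LHS](to_coords_pref hM x) Ex.
Qed.

End Connection.

(** * Horizontal and vertical lifts in a chart *)

Section Lift.
Variables (R : realType) (n : nat) (M : atlas R n).
Hypothesis hM : is_manifold M.
Variable D : (M -> 'rV[R]_n) -> (M -> 'rV[R]_n) -> M -> 'rV[R]_n.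
Hypothesis hD : linear_connection D.
Notation TM := (tangent_bundle M).
Implicit Types (i j k : chart_index M) (x : M) (a : TM).
Let hTM := tangent_bundle_manifold hM.

(** In the preferred chart, the curve defining [chi] is affine in the fibre and
constant in the base. *)
Lemma chiE a u : chi a u = row_mx 0 u.
Proof.
rewrite /chi /velocity /derive1; apply/lim_near_cst => //.
near=> h; have hn0 : h != 0 by near: h; exact: nbhs_dnbhs_neq.
rewrite /= !to_coords_pref // addr0 scale0r addr0.
rewrite opp_row_mx add_row_mx subrr addrC addKr scale_row_mx scaler0.
by rewrite scalerA mulVf // scale1r.
Unshelve. all: by end_near. Qed.

Lemma tm_to_coords_vertical i a u : dom M i a.1 ->
  @to_coords R (n + n) TM i a (row_mx 0 u) = row_mx 0 (to_coords i a.1 u).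
Proof.
move=> ia; have pa := mfd_pref hM a.1; have oa := overlap_chart pa ia.
have cE : chart TM (pref TM a) a = row_mx (chart M (pref M a.1) a.1) a.2.
  by rewrite /= to_coords_pref.
apply: (diff_affine_line (f := trans (M := TM) (pref TM a) i)).
  exact: (trans_differentiable hTM (i := pref TM a) (j := i) (x := a)).
move=> h; rewrite cE scale_row_mx scaler0 add_row_mx add0r.
rewrite !(tm_transE hM) ?row_mxKl ?row_mxKr //.
by rewrite linearP /= scale_row_mx add_row_mx scaler0 addr0 addrC.
Qed.

(** In the charts of M and TM indexed by [i], the section z |-> (z, Y z) becomes
y |-> (y, Y_i y). Changing charts for the section as a whole, rather than for
its derivative, avoids the second derivatives of the transition maps. *)
Lemma tm_to_coords_section i a Y v : smooth_field Y -> Y a.1 = a.2 ->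
  dom M i a.1 ->
  @to_coords R (n + n) TM i a
    (@tangent_map R n (n + n) M TM (fun x => (x, Y x)) a.1 v) =
  row_mx (to_coords i a.1 v)
    ('d (field_coords i Y) (chart M i a.1) (to_coords i a.1 v)).
Proof.
move=> sY Ya ia; have pa := mfd_pref hM a.1; set p := pref M a.1 in pa *.
pose s x : TM := (x, Y x).
have sa : s a.1 = a by rewrite /s Ya; case: (a).
have ds k : dom M k a.1 -> is_diff (chart M k a.1) (chart TM k \o s \o cochart M k)
    (fun w => row_mx w ('d (field_coords k Y) (chart M k a.1) w)).
  move=> ka; have oA := chart_range_open hM (i := k).
  have ra := chart_range_chart ka.
  apply: (eq_on_is_diff oA ra (f := fun y => row_mx y (field_coords k Y y))).
    by move=> y; rewrite inE => ky; rewrite /= (cochartK hM ky).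
  have did : is_diff (chart M k a.1) (fun y => y) (fun w => w) by exact: is_diff_id.
  exact: (is_diff_row_mx did (differentiableP (smooth_differentiable (sY k) ra))).
have [dsi dsiE] := ds i ia.
have ch := diff_change (F := chart TM i \o s) hM pa ia dsi v.
have {}ch : 'd (chart TM i \o s \o cochart M p) (chart M p a.1) v =
    row_mx (to_coords i a.1 v)
    ('d (field_coords i Y) (chart M i a.1) (to_coords i a.1 v)).
  rewrite -[LHS]/('d ((chart TM i \o s) \o cochart M p) (chart M p a.1) v) ch.
  exact: (congr1 (fun f : 'rV[R]_n -> 'rV[R]_(n + n) => f _) dsiE).
rewrite -ch.
have eb : (chart TM p \o s \o cochart M p) (chart M p a.1) = chart TM p a.
  by rewrite -[LHS]/(chart TM p (s (cochart M p (chart M p a.1)))) mfd_chartK // sa.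
have dt : differentiable (trans (M := TM) p i)
    ((chart TM p \o s \o cochart M p) (chart M p a.1)).
  rewrite eb; exact: (trans_differentiable hTM (i := p) (j := i) (x := a)).
have [dsp _] := ds p pa.
have := is_diff_comp (differentiableP dsp) (differentiableP dt).
move=> /(eq_on_is_diff (chart_range_open hM (i := p)) (chart_range_chart pa)
   (g := chart TM i \o s \o cochart M p)) h.
have [|_ e] := h.
  move=> y; rewrite inE => py.
  have dp := chart_range_dom hM py.
  exact: (congr1 (chart TM i) (mfd_chartK hTM (i := p) (x := s (cochart M p y)) dp)).
have {}e := congr1 (fun f : 'rV[R]_n -> 'rV[R]_(n + n) => f v) e.
rewrite [RHS]e [in RHS]eb; exact: erefl.
Qed.

(** Up to sign, the vertical component of the horizontal lift of [v] at [u], for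
the Christoffel symbols [G l m] of nabla_(E l) (E m): the differentiated field
[m] goes with [u], the direction [l] with [v]. *)
Definition christoffel (G : 'I_n -> 'I_n -> 'rV[R]_n -> 'rV[R]_n)
    (y u v : 'rV[R]_n) : 'rV[R]_n :=
  \sum_l \sum_m (rv_coord m u * rv_coord l v : R) *: G l m y.

Lemma christoffel_linear G y u : linear (christoffel G y u).
Proof.
move=> c v w; rewrite /christoffel scaler_sumr -big_split; apply: eq_bigr => l _.
rewrite scaler_sumr -big_split; apply: eq_bigr => m _ /=.
by rewrite linearP /= mulrDr scalerDl scalerA mulrCA.
Qed.

(** Whatever the fields X and Y chosen in the definition of the lift, the
derivative of the components of Y cancels between the tangent map of Y and
nabla_X Y; only the Christoffel symbols remain. So the lift does not depend on
the choices, and it is smooth. *)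
Lemma hlift_chart i x0 : dom M i x0 -> exists (U : set 'rV[R]_n)
    (G : 'I_n -> 'I_n -> 'rV[R]_n -> 'rV[R]_n),
  [/\ open U /\ U (chart M i x0), U `<=` chart_range i,
      forall l m, smooth_on U (G l m) &
      forall a v, dom M i a.1 -> U (chart M i a.1) ->
        @to_coords R (n + n) TM i a (hlift D a v) =
        row_mx (to_coords i a.1 v) (- christoffel G (chart M i a.1)
          (to_coords i a.1 a.2) (to_coords i a.1 v))].
Proof.
move=> ix0; have [U [E [oU UA sE _ DE]]] := local_frame hM hD ix0.
exists U, (fun l m => field_coords i (D (E l) (E m))); split=> //.
  by move=> l m k; apply: Ck_on_sub UA _; exact: (conn_smooth hD).
move=> a v ia Ua; rewrite /hlift.
set S := [set w | _]; have Sne : exists w, S w.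
  have [X sX Xa] := smooth_field_through hM hD a.1 v.
  have [Y sY Ya] := smooth_field_through hM hD a.1 a.2.
  by eexists; exists X, Y.
have [w Sw] := Sne.
have [X [Y [sX sY Xa Ya ->]]] := xgetPex 0 Sne.
rewrite linearB /= tm_to_coords_section // chiE tm_to_coords_vertical //.
rewrite opp_row_mx add_row_mx oppr0 addr0; congr row_mx.
rewrite DE // Xa Ya opprD addrA subrr add0r /christoffel; congr (- _).
by apply: eq_bigr => l _; apply: eq_bigr => m _; rewrite /field_coords mfd_chartK.
Qed.

(** The map [Psi] after identifying the covector [alpha] with the vector
[sharp alpha]. Working with it removes all duality from the sequel. *)
Definition hvlift a (v u : 'rV[R]_n) : 'rV[R]_(n + n) := hlift D a v + chi a u.

(** In the splitting of the preferred chart, the sum of the lifts is a shear, hence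
a linear isomorphism. *)
Lemma hvlift_fiber a : exists B : {linear 'rV[R]_n -> 'rV[R]_n},
  forall v u, hvlift a v u = row_mx v (u - B v).
Proof.
have pa := mfd_pref hM a.1; have [U [G [[_ Ua] _ _ h]]] := hlift_chart pa.
pose B := christoffel G (chart M (pref M a.1) a.1) a.2.
have lB : linear B := christoffel_linear _ _ _.
pose BM := GRing.isLinear.Build _ _ _ _ _ lB.
pose BL : {linear _ -> _} := HB.pack B BM.
exists BL => v u; rewrite /hvlift chiE.
have := h a v pa Ua; rewrite !to_coords_pref // => e.
by rewrite e add_row_mx addr0 addrC.
Qed.

End Lift.

(** * The musical isomorphisms *)

Section Musical.
Variables (R : realType) (n : nat) (M : atlas R n).
Variable g : M -> 'rV[R]_n -> 'rV[R]_n -> R.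
Hypothesis hg : riemannian_metric g.
Implicit Types (x : M) (u v w : 'rV[R]_n).

Lemma metricDr x u c v w : g x u (c *: v + w) = c * g x u v + g x u w.
Proof. exact: (riem_linear hg). Qed.

Lemma metricDl x u c v w : g x (c *: v + w) u = c * g x v u + g x w u.
Proof. by rewrite !(riem_sym hg x _ u) metricDr. Qed.

Lemma metric0r x u : g x u 0 = 0.
Proof.
by have := metricDr x u (-1) 0 0; rewrite scaleN1r mulN1r !addNr.
Qed.

Lemma metric_ge0 x u : 0 <= g x u u.
Proof.
by have [->|/(riem_pos hg x)/ltW//] := eqVneq u 0; rewrite metric0r.
Qed.

Lemma flatE x u v : flat g x u v = g x u v.
Proof.
have lg : linear (g x u : 'rV[R]_n -> R^o) := riem_linear hg x u.
pose gM := GRing.isLinear.Build _ _ _ _ _ lg.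
pose gL : {linear 'rV[R]_n -> R^o} := HB.pack (g x u : 'rV[R]_n -> R^o) gM.
exact: (lfunE gL).
Qed.

Lemma metric_inj x u v : (forall w, g x u w = g x v w) -> u = v.
Proof.
move=> uv; apply/eqP; rewrite -subr_eq0; apply/negPn/negP => /(riem_pos hg x).
rewrite -[X in g x X _]addrC -scaleN1r metricDl uv mulN1r addNr.
by rewrite ltxx.
Qed.

(** The Gram matrix of the metric in the standard basis has trivial kernel by
positivity, hence is invertible. *)
Lemma metric_represents x (alpha : 'rV[R]_n -> R) : linear (alpha : _ -> R^o) ->
  exists u, forall v, g x u v = alpha v.
Proof.
move=> la; pose aM := GRing.isLinear.Build _ _ _ _ _ la.
pose aL : {linear 'rV[R]_n -> R^o} := HB.pack (alpha : 'rV[R]_n -> R^o) aM.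
have lg u : linear (g x u : 'rV[R]_n -> R^o) := riem_linear hg x u.
pose gM u := GRing.isLinear.Build _ _ _ _ _ (lg u).
pose gL u : {linear 'rV[R]_n -> R^o} := HB.pack (g x u : 'rV[R]_n -> R^o) (gM u).
pose A : 'M[R]_n := \matrix_(i, j) g x (rv_basis R i) (rv_basis R j).
have gA u j : g x u (rv_basis R j) = (u *m A) ord0 j.
  rewrite (riem_sym hg) -[LHS]/(gL (rv_basis R j) u) linear_rv_sum mxE.
  by apply: eq_bigr => i _; rewrite /= mxE (riem_sym hg).
have uA : A \in unitmx.
  rewrite -row_free_unit; apply: inj_row_free => u uA0.
  apply: (@metric_inj x) => w; rewrite (riem_sym hg x 0) -[LHS]/(gL u w).
  rewrite -[RHS]/(gL w 0) linear0 linear_rv_sum big1 // => j _ /=.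
  by rewrite gA uA0 mxE scaler0.
pose a : 'rV[R]_n := \row_j alpha (rv_basis R j).
exists (a *m invmx A) => v.
rewrite -[LHS]/(gL _ v) -[RHS]/(aL v) !linear_rv_sum; apply: eq_bigr => j _ /=.
by rewrite gA mulmxKV // mxE.
Qed.

Lemma sharp_flat x u : sharp g x (flat g x u) = u.
Proof.
apply: xget_unique => // v vu; apply: (@metric_inj x) => w.
by rewrite -!flatE vu.
Qed.

Lemma flat_sharp x (alpha : 'Hom('rV[R]_n, R^o)) :
  flat g x (sharp g x alpha) = alpha.
Proof.
have [u ua] := metric_represents x (alpha := alpha) (linearP alpha).
have e : flat g x u = alpha by apply/lfunP => v; rewrite flatE ua.
by rewrite -e sharp_flat.
Qed.

(** Self-adjointness of [J] turns its transpose into [J] itself under [flat]. *)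
Lemma dualJ_flat (J : M -> 'rV[R]_n -> 'rV[R]_n) x u : linear (J x) ->
  (forall v w, g x (J x v) w = g x v (J x w)) ->
  dualJ J x (flat g x u) = flat g x (J x u).
Proof.
move=> lJ Jg; apply/lfunP => v; rewrite flatE Jg /dualJ.
pose JM := GRing.isLinear.Build _ _ _ _ _ lJ.
pose JL : {linear _ -> _} := HB.pack (J x) JM.
rewrite (lfunE (flat g x u \o JL : {linear 'rV[R]_n -> R^o})) /=.
by rewrite flatE.
Qed.

End Musical.

(** * The metallic structure of the tangent bundle *)

Section BarStructures.
Variables (R : realType) (n : nat) (M : atlas R n) (p q : R).
Variables (J : M -> 'rV[R]_n -> 'rV[R]_n) (g : M -> 'rV[R]_n -> 'rV[R]_n -> R).
Variable D : (M -> 'rV[R]_n) -> (M -> 'rV[R]_n) -> M -> 'rV[R]_n.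
Hypotheses (hJg : metallic_riemannian p q J g) (hD : linear_connection D).
Notation TM := (tangent_bundle M).
Implicit Types (i j k : chart_index M) (x : M) (a : TM).
Let hM := metallic_manifold hJg.
Let hg := metallic_metric hJg.
Let hTM := tangent_bundle_manifold hM.

Lemma J_linear x : linear (J x).
Proof. by case: (metallic_tensor hJg). Qed.
HB.instance Definition _ x := GRing.isLinear.Build R 'rV[R]_n 'rV[R]_n _ (J x) (J_linear x).

Lemma hvlift_inj a v u v' u' : hvlift D a v u = hvlift D a v' u' -> v = v' /\ u = u'.
Proof.
have [B hB] := hvlift_fiber hM hD a; rewrite !hB => /eq_row_mx[-> e].
by split=> //; apply: (addIr (- B v')).
Qed.

Lemma hvlift_surj a w : exists v u, w = hvlift D a v u.
Proof.
have [B hB] := hvlift_fiber hM hD a.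
by exists (lsubmx w), (rsubmx w + B (lsubmx w)); rewrite hB addrK hsubmxK.
Qed.

Lemma hvlift_linear a c v u v' u' :
  c *: hvlift D a v u + hvlift D a v' u' = hvlift D a (c *: v + v') (c *: u + u').
Proof.
have [B hB] := hvlift_fiber hM hD a; rewrite !hB scale_row_mx add_row_mx; congr row_mx.
by rewrite linearP scalerBr opprD addrACA.
Qed.

Lemma hvlift0 a : hvlift D a 0 0 = 0.
Proof.
have := hvlift_linear a (-1) 0 0 0 0.
by rewrite !scaleN1r !addNr => <-.
Qed.

Lemma hvliftZ a c v u : c *: hvlift D a v u = hvlift D a (c *: v) (c *: u).
Proof. by rewrite -[LHS]addr0 -(hvlift0 a) hvlift_linear !addr0. Qed.

Lemma Psi_inv_hvlift a v u : Psi_inv g D a (hvlift D a v u) = (v, flat g a.1 u).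
Proof.
apply: xget_unique => [|[v' al] /= e].
  by rewrite /Psi /= (sharp_flat hg).
have [/= -> <-] := hvlift_inj e.
by rewrite (flat_sharp hg).
Qed.

(** By [dualJ_flat] the transpose acts on the second summand as J itself. This and
[barg_hvlift] are the two formulas from which the algebraic identities follow. *)
Lemma barJ_hvlift a v u : barJ J g D a (hvlift D a v u) = hvlift D a (J a.1 v) (J a.1 u).
Proof.
rewrite /barJ Psi_inv_hvlift /hatJ /Psi /= (dualJ_flat hg) ?(sharp_flat hg) //.
- exact: J_linear.
- exact: (metallic_compat hJg).
Qed.

Lemma barg_hvlift a v u v' u' :
  barg g D a (hvlift D a v u) (hvlift D a v' u') = g a.1 v v' + g a.1 u u'.
Proof.
apply: etrans (congr2 (hatg g a.1) (Psi_inv_hvlift a v u) (Psi_inv_hvlift a v' u')) _.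
by rewrite /hatg /= (sharp_flat hg) (sharp_flat hg).
Qed.

Lemma Ck_christoffel (V : normedModType R) m (O : set V) (U : set 'rV[R]_n)
    (G : 'I_n -> 'I_n -> 'rV[R]_n -> 'rV[R]_n) (h u v : V -> 'rV[R]_n) :
  open O -> open U -> (forall y, O y -> U (h y)) ->
  (forall l l', smooth_on U (G l l')) ->
  Ck_on m O h -> Ck_on m O u -> Ck_on m O v ->
  Ck_on m O (fun y => christoffel G (h y) (u y) (v y)).
Proof.
move=> oO oU OU sG ch cu cv.
have cc := @rv_coord_continuous R n.
apply: Ck_sum => // l; apply: Ck_sum => // l'; apply: CkZ => //.
  by apply: (CkZ oO (Ck_linear_comp _ oO cu) (Ck_linear_comp _ oO cv)); exact: cc.
exact: (Ck_comp (fin_coords_rV R n) oO oU OU ch (sG l l' m)).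
Qed.

(** The chart expression of [hvlift] solved for its arguments: since the shear by
the Christoffel symbols is explicit, so is its inverse, and no matrix inversion
is needed for smoothness. *)
Lemma bar_chart i (y0 : 'rV[R]_(n + n)) : @chart_range R (n + n) TM i y0 ->
  exists (U : set 'rV[R]_n) (G : 'I_n -> 'I_n -> 'rV[R]_n -> 'rV[R]_n),
  [/\ open U, U (lsubmx y0), U `<=` chart_range i,
      forall l m, smooth_on U (G l m) &
      forall y v u, U (lsubmx y) ->
      let x := cochart M i (lsubmx y) in
      @of_coords R (n + n) TM i (cochart TM i y) (row_mx v (u - christoffel G (lsubmx y) (rsubmx y) v))
      = hvlift D (cochart TM i y) (of_coords i x v) (of_coords i x u)].
Proof.
rewrite (tm_chart_rangeE hM) => /= iy0.
have i0 := chart_range_dom hM iy0.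
have [U [G [[oU Ux] UA sG hG]]] := hlift_chart hM hD i0.
exists U, G; split=> //; first by rewrite -(cochartK hM iy0).
move=> y v u Uy; pose x := cochart M i (lsubmx y); rewrite -/x.
have ix : dom M i x by apply: (chart_range_dom hM); exact: UA.
have xy : chart M i x = lsubmx y by apply: (cochartK hM); exact: UA.
set a : TM := (x, _).
rewrite -[RHS](to_coordsK hTM (i := i) (x := a)) //; congr of_coords.
have -> : @to_coords R (n + n) TM i a (hvlift D a (of_coords i x v) (of_coords i x u)) =
    @to_coords R (n + n) TM i a (hlift D a (of_coords i x v)) +
    @to_coords R (n + n) TM i a (chi a (of_coords i x u)) by exact: linearD.
have Ua : U (chart M i a.1) by rewrite /= xy.
have -> := hG a (of_coords i x v) ix Ua.
rewrite (chiE hM); have -> := tm_to_coords_vertical hM (i := i) (a := a) (of_coords i x u) ix.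
rewrite add_row_mx addr0 /= !(of_coordsK hM) // xy addrC.
by [].
Qed.

Definition J_coords i (y c : 'rV[R]_n) : 'rV[R]_n :=
  let x := cochart M i y in to_coords i x (J x (of_coords i x c)).

HB.instance Definition _ i y := GRing.Linear.copy (J_coords i y)
  (to_coords i (cochart M i y) \o (J (cochart M i y) \o of_coords i (cochart M i y))).

Definition g_coords i (y c c' : 'rV[R]_n) : R^o :=
  let x := cochart M i y in g x (of_coords i x c) (of_coords i x c').

Lemma Ck_J_coords (V : normedModType R) m (O : set V) i (h c : V -> 'rV[R]_n) :
  open O -> (forall y, O y -> chart_range i (h y)) ->
  Ck_on m O h -> Ck_on m O c -> Ck_on m O (fun y => J_coords i (h y) (c y)).
Proof.
move=> oO OA ch cc; have oA := chart_range_open hM (i := i).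
apply: (Ck_on_eq oO (f := fun y =>
    \sum_j rv_coord j (c y) *: J_coords i (h y) (rv_basis R j))).
  by move=> y _; rewrite -linear_rv_sum.
apply: Ck_sum => // j; apply: CkZ => //.
  by apply: Ck_linear_comp => //; exact: rv_coord_continuous.
have [_ sJ] := metallic_tensor hJg.
exact: (Ck_comp (fin_coords_rV R n) oO oA OA ch (sJ i (rv_basis R j) m)).
Qed.

Lemma Ck_g_coords (V : normedModType R) m (O : set V) i
    (h c c' : V -> 'rV[R]_n) :
  open O -> (forall y, O y -> chart_range i (h y)) ->
  Ck_on m O h -> Ck_on m O c -> Ck_on m O c' ->
  Ck_on m O (fun y => g_coords i (h y) (c y) (c' y)).
Proof.
move=> oO OA ch cc cc'; have oA := chart_range_open hM (i := i).
have lg x u : linear (g x u : 'rV[R]_n -> R^o) := riem_linear hg x u.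
pose gM x u := GRing.isLinear.Build _ _ _ _ _ (lg x u).
pose gL x u : {linear 'rV[R]_n -> R^o} := HB.pack (g x u : 'rV[R]_n -> R^o) (gM x u).
have g_sum y v v' : g_coords i y v v' = \sum_l \sum_l'
    rv_coord l v *: (rv_coord l' v' *: g_coords i y (rv_basis R l) (rv_basis R l')).
  rewrite /g_coords; set x := cochart M i y.
  have gs (s t : 'rV[R]_n) : g x (of_coords i x s) (of_coords i x t) =
      \sum_l rv_coord l t *: (g x (of_coords i x s) (of_coords i x (rv_basis R l)) : R^o).
    exact: (linear_rv_sum (gL x (of_coords i x s) \o of_coords i x : {linear 'rV[R]_n -> R^o}) t).
  rewrite (riem_sym hg) gs; apply: eq_bigr => l _.
  by rewrite (riem_sym hg) gs scaler_sumr.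
apply: (Ck_on_eq oO (f := fun y => \sum_l \sum_l' rv_coord l (c y) *:
    (rv_coord l' (c' y) *: g_coords i (h y) (rv_basis R l) (rv_basis R l')))).
  by move=> y _; rewrite g_sum.
apply: Ck_sum => // l; apply: Ck_sum => // l'.
have sg := @riem_smooth R n M g hg i (rv_basis R l) (rv_basis R l') m.
apply: (CkZ oO); last apply: (CkZ oO).
- by apply: (Ck_linear_comp _ oO cc); exact: rv_coord_continuous.
- by apply: (Ck_linear_comp _ oO cc'); exact: rv_coord_continuous.
- exact: (Ck_comp (fin_coords_rV R n) oO oA OA ch sg).
Qed.

(** The vertical coordinate [u] in [bar_chart] of the vector of T(TM) that has
coordinates [w] in the chart of TM, at the point of coordinates [y]. *)
Definition vcoord (G : 'I_n -> 'I_n -> 'rV[R]_n -> 'rV[R]_n)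
    (w y : 'rV[R]_(n + n)) : 'rV[R]_n :=
  rsubmx w + christoffel G (lsubmx y) (rsubmx y) (lsubmx w).

Section LocalSmoothness.
Variables (U : set 'rV[R]_n) (G : 'I_n -> 'I_n -> 'rV[R]_n -> 'rV[R]_n).
Hypotheses (oU : open U) (sG : forall l l', smooth_on U (G l l')).
Let O : set 'rV[R]_(n + n) := lsubmx @^-1` U.
Let oO : open O := lsubmx_open oU.

Lemma Ck_basepoint m : Ck_on m O (fun y => lsubmx y : 'rV[R]_n).
Proof. exact/Ck_lsubmx/Ck_id. Qed.

Lemma Ck_vcoord m w : Ck_on m O (vcoord G w).
Proof.
apply: (CkD oO); first exact: (Ck_cst m (rsubmx w)).
apply: (Ck_christoffel oO oU) => //; first exact: Ck_basepoint.
- exact/Ck_rsubmx/Ck_id.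
- exact: Ck_cst.
Qed.

End LocalSmoothness.

(** In a chart of TM, with c the vertical coordinate [vcoord] of [w], the structure
sends [w] to the vector of components J(w_h) and J(c) - Gamma(u, J(w_h)),
where w_h is the base part of [w] and u the fibre coordinate of the point. All of
them depend smoothly on the point. *)
Lemma barJ_smooth i w : smooth_on (@chart_range R (n + n) TM i)
  (fun y => @to_coords R (n + n) TM i (cochart TM i y)
     (barJ J g D (cochart TM i y) (@of_coords R (n + n) TM i (cochart TM i y) w))).
Proof.
move=> k; apply: Ck_on_local => y0 iy0.
have [U [G [oU Uy0 UA sG hG]]] := bar_chart iy0.
have oO := lsubmx_open oU; exists (lsubmx @^-1` U) => //.
have OA (y : 'rV[R]_(n + n)) : U (lsubmx y) -> chart_range i (lsubmx y) by move=> /UA.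
apply: (Ck_on_eq oO (f := fun y =>
  row_mx (J_coords i (lsubmx y) (lsubmx w))
    (J_coords i (lsubmx y) (vcoord G w y) +
     -%R (christoffel G (lsubmx y) (rsubmx y) (J_coords i (lsubmx y) (lsubmx w)))))).
  move=> y; rewrite inE => Uy; have iy := OA y Uy.
  have dy := chart_range_dom hM iy.
  have -> : @of_coords R (n + n) TM i (cochart TM i y) w =
     hvlift D (cochart TM i y) (of_coords i (cochart M i (lsubmx y)) (lsubmx w))
        (of_coords i (cochart M i (lsubmx y)) (vcoord G w y)).
    by rewrite -hG // /vcoord addrK hsubmxK.
  rewrite barJ_hvlift -[J _ (of_coords i _ (lsubmx w))](to_coordsK hM _ dy).
  rewrite -[J _ (of_coords i _ (vcoord G w y))](to_coordsK hM _ dy).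
  by rewrite -hG // (of_coordsK hTM).
have cJ := Ck_J_coords oO OA (Ck_basepoint oU k) (Ck_cst k (lsubmx w) oO).
apply: (Ck_row_mx oO cJ); apply: (CkD oO).
  exact: (Ck_J_coords oO OA (Ck_basepoint oU k) (Ck_vcoord oU sG k w)).
apply: (Ck_linear_comp (L := -%R : {linear 'rV[R]_n -> 'rV[R]_n})) => //.
  by move=> x; apply: opp_continuous.
apply: (Ck_christoffel oO oU) => //; first exact: Ck_basepoint.
exact/Ck_rsubmx/Ck_id.
Qed.

Lemma barg_smooth i w w' : smooth_on (@chart_range R (n + n) TM i)
  (fun y => barg g D (cochart TM i y)
     (@of_coords R (n + n) TM i (cochart TM i y) w)
     (@of_coords R (n + n) TM i (cochart TM i y) w') : R^o).
Proof.
move=> k; apply: Ck_on_local => y0 /bar_chart[U [G [oU Uy0 UA sG hG]]].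
have oO := lsubmx_open oU; exists (lsubmx @^-1` U) => //.
have OA (y : 'rV[R]_(n + n)) : U (lsubmx y) -> chart_range i (lsubmx y) by move=> /UA.
apply: (Ck_on_eq oO (f := fun y =>
  g_coords i (lsubmx y) (lsubmx w) (lsubmx w') +
  g_coords i (lsubmx y) (vcoord G w y) (vcoord G w' y))).
  move=> y; rewrite inE => Uy.
  have wE t : @of_coords R (n + n) TM i (cochart TM i y) t =
     hvlift D (cochart TM i y) (of_coords i (cochart M i (lsubmx y)) (lsubmx t))
        (of_coords i (cochart M i (lsubmx y)) (vcoord G t y)).
    by rewrite -hG // /vcoord addrK hsubmxK.
  by rewrite (wE w) (wE w') barg_hvlift.
have cb := Ck_basepoint oU k.
apply: (CkD oO).
  exact: (Ck_g_coords oO OA cb (Ck_cst _ _ oO) (Ck_cst _ _ oO)).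
exact: (Ck_g_coords oO OA cb (Ck_vcoord oU sG k w) (Ck_vcoord oU sG k w')).
Qed.

Lemma barJ_tensor : tensor11 (M := TM) (barJ J g D).
Proof.
split=> [a c w w'|i w]; last exact: barJ_smooth.
have [[v [u ->]] [v' [u' ->]]] := (hvlift_surj a w, hvlift_surj a w').
move: (barJ J g D a) (hvlift D a) (barJ_hvlift a) (hvlift_linear a) => b h bE hL.
by rewrite hL !bE hL !linearP.
Qed.

Lemma barg_metric : riemannian_metric (M := TM) (barg g D).
Proof.
split=> [a w c w1 w2|a w w'|a w|i w w']; last exact: barg_smooth.
- have [v [u ->]] := hvlift_surj a w.
  have [[v1 [u1 ->]] [v2 [u2 ->]]] := (hvlift_surj a w1, hvlift_surj a w2).
  move: (barg g D a) (hvlift D a) (barg_hvlift a) (hvlift_linear a) => b h bE hL.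
  by rewrite hL !bE (metricDr hg) (metricDr hg) addrACA -mulrDr.
- have [[v [u ->]] [v' [u' ->]]] := (hvlift_surj a w, hvlift_surj a w').
  move: (barg g D a) (hvlift D a) (barg_hvlift a) => b h bE.
  by rewrite (bE v u) (bE v' u') (riem_sym hg a.1 v) (riem_sym hg a.1 u).
- have [v [u ->]] := hvlift_surj a w; rewrite barg_hvlift => ne.
  have gv := metric_ge0 hg a.1 v; have gu := metric_ge0 hg a.1 u.
  have [v0|/(riem_pos hg a.1) v0] := eqVneq v 0; last exact: ltr_wpDr.
  have [u0|/(riem_pos hg a.1) u0] := eqVneq u 0; last exact: ltr_wpDl.
  by move: ne; rewrite v0 u0 hvlift0 eqxx.
Qed.

Lemma bar_metallic : metallic_riemannian (M := TM) p q (barJ J g D) (barg g D).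
Proof.
split=> [||| a w|a w w'].
- exact: hTM.
- exact: barJ_tensor.
- exact: barg_metric.
- have [v [u ->]] := hvlift_surj a w.
  move: (barJ J g D a) (hvlift D a) (barJ_hvlift a) (hvlift_linear a) (hvliftZ a) => b h bE hL hZ.
  by rewrite bE bE (hZ q) hL (metallic_eq hJg a.1 v) (metallic_eq hJg a.1 u).
- have [[v [u ->]] [v' [u' ->]]] := (hvlift_surj a w, hvlift_surj a w').
  move: (barJ J g D a) (barg g D a) (hvlift D a) (barJ_hvlift a) (barg_hvlift a).
  move=> bJ bg h JE gE.
  by rewrite (JE v u) (JE v' u') (gE _ _ v') (gE v) !(metallic_compat hJg).
Qed.

End BarStructures.

Theorem proposition3p1 (R : realType) (n : nat) (M : atlas R n) (p q : R)
    (J : M -> 'rV[R]_n -> 'rV[R]_n) (g : M -> 'rV[R]_n -> 'rV[R]_n -> R)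
    (D : (M -> 'rV[R]_n) -> (M -> 'rV[R]_n) -> M -> 'rV[R]_n)
    (hM : metallic_riemannian p q J g) (hD : linear_connection D) :
  metallic_riemannian (M := tangent_bundle M) p q (barJ J g D) (barg g D).
Proof. exact: bar_metallic. Qed.
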